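(* Let $(\mathcal G,\mathcal S)$ satisfy Axioms (i)–(iv), (vi), (vii) and (viii) of the context, let $\mathcal D=\mathcal C^A(\mathcal G,\mathcal S)$, $F\in\mathcal F^A_{\mathcal D,R}$ and $G\in\mathcal G$. If $|G|$ is invertible in $R$, then $m_{F,G}:F_+(G)\to F^+(G)$ and $|G|^{-1}n_{F,G}:F^+(G)\to F_+(G)$ are mutually inverse isomorphisms.
   Context: $A$ is a multiplicatively written abelian group (not necessarily finite), $R$ is a commutative ring with unity, all groups $G,H,K,\dots$ are finite. Pairs. $G^*=\mathrm{Hom}(G,A)$. $\mathcal M(G)$ is the set of pairs $(K,\kappa)$ with $K\le G$, $\kappa\in K^*$, ordered by $(L,\phi)\le(K,\kappa)$ iff $L\le K$ and $\phi=\kappa|_L$; $G$ acts by ${}^g(K,\kappa)=({}^gK,{}^g\kappa)$, ${}^gK=gKg^{-1}$, ${}^g\kappa(gkg^{-1})=\kappa(k)$. For $D\le G\times H$, $p_1,p_2$ are the projections, $k_1(D)=\{g:(g,1)\in D\}$, $k_2(D)=\{h:(1,h)\in D\}$. For $(D,\phi)\in\mathcal M(G\times H)$ put $\phi_1(g)=\phi(g,1)$ on $k_1(D)$ and $\phi_2(h)=\phi(1,h)^{-1}$ on $k_2(D)$. For $V\le H\times K$, $D*V=\{(g,k):\exists h,\ (g,h)\in D,(h,k)\in V\}$; if $(V,\psi)\in\mathcal M(H\times K)$ and $\phi_2=\psi_1$ on $k_2(D)\cap k_1(V)$, then $(\phi*\psi)(g,k)=\phi(g,h)\psi(h,k)$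 (any such $h$) and $(D,\phi)*(V,\psi)=(D*V,\phi*\psi)$. For $K\le H$, $D*K=\{g:\exists k\in K,(g,k)\in D\}$; for $K\le G$, $K*D=\{h:\exists k\in K,(k,h)\in D\}$. $\Delta(K)=\{(k,k):k\in K\}$, $1$ is the trivial homomorphism. A pair $(D,\phi)$ is regarded as an element of $\mathcal M(G'\times H')$ for any $G',H'$ with $D\le G'\times H'$. Fibered bisets. An $A$-fibered $G$-set is a $(G\times A)$-set with finitely many $A$-orbits on which $A$ acts freely; morphisms are $(G\times A)$-equivariant maps. For $x$ in an $A$-fibered $G$-set, $(G_x,\phi_x)$ denotes the stabilizer of its $A$-orbit and the homomorphism with $gx=\phi_x(g)x$. An $A$-fibered $(G,H)$-biset is an $A$-fibered $(G\times H)$-set, with $gauhb=((g,h^{-1}),ab)u$. $B^A(G,H)$ is the Grothendieck group under disjoint union, $B^A_R(G,H)=R\otimes_{\mathbb Z} B^A(G,H)$. $\left[\frac{G\times H}{D,\phi}\right]$ is the class of $(G\times H\times A)/\{(g,h,\phi(g,h)^{-1}):(g,h)\in D\}$. $U\otimes_{AH}V$ is the set of those $(H\times A)$-orbits of $U\times V$ under $(h,a)(u,v)=(u(ha)^{-1},hav)$ on which the induced $A$-action is free. $\mathcal C^A$ is the category with objects finite groups, $\mathrm{Hom}_{\mathcal C^A}(H,G)=B^A_R(G,H)$, composition induced by $\otimes_{AH}$, identities $\left[\frac{G\times G}{\Delta(G),1}\right]$. $\mathrm{Res}^K_L=\left[\frac{L\times K}{\Delta(L),1}\right]$ for $L\le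 K$. Data. $\mathcal G$ is a class of finite groups, $\Sigma_{\mathcal G}(G)=\{H\le G: H\in\mathcal G\}$, and $\mathcal S$ is a family of subsets $\mathcal S(G,H)\subseteq\mathcal M(G\times H)$, $G,H\in\mathcal G$. Axioms: (i) $(\Delta(G),1)\in\mathcal S(G,G)$ for $G\in\mathcal G$. (ii) $\mathcal S(G,H)$ is closed under $(G\times H)$-conjugation. (iii) For $(V,\phi)\in\mathcal S(G,H)$, $(U,\psi)\in\mathcal S(H,K)$ with $\phi_2=\psi_1$ on $k_2(V)\cap k_1(U)$: $(V*U,\phi*\psi)\in\mathcal S(G,K)$. (iv) For $(D,\phi)\in\mathcal S(G,H)$ and $K\in\Sigma_{\mathcal G}(H)$: $D*K\in\mathcal G$ and $(D,\phi)*(\Delta(K),1)\in\mathcal S(D*K,K)$. (vi) For $G\in\mathcal G$, $H\in\Sigma_{\mathcal G}(G)$: $(\Delta(H),1)\in\mathcal S(H,G)$. (vii) For $(D,\phi)\in\mathcal S(G,H)$: $p_2(D)\in\mathcal G$, and for all $K\in\Sigma_{\mathcal G}(p_2(D))$, $D*K\in\mathcal G$ and $(D,\phi)*(\Delta(K),1)\in\mathcal S(D*K,K)$. (viii) For $(D,\phi)\in\mathcal S(G,H)$: $p_1(D)\in\mathcal G$, and for all $K\in\Sigma_{\mathcal G}(p_1(D))$, $K*D\in\mathcal G$ and $(\Delta(K),1)*(D,\phi)\in\mathcal S(K,K*D)$. $\mathcal C^A(\mathcal G,\mathcal S)$ is the subcategory of $\mathcal C^A$ with object class $\mathcal G$ in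 which the morphisms from $H$ to $G$ are the $R$-span of the $\left[\frac{G\times H}{D,\phi}\right]$ with $(D,\phi)\in\mathcal S(G,H)$. $\mathcal F^A_{\mathcal D,R}$ is the category of $R$-linear functors $\mathcal D\to R\text{-Mod}$. The modules. For $g\in G$, $L\in\Sigma_{\mathcal G}(G)$, ${}^g:F(L)\to F({}^gL)$ is $F$ applied to $\left[\frac{{}^gL\times L}{\{(glg^{-1},l):l\in L\},1}\right]$. $\Gamma_F(G)$ has objects $(X,s)$ with $X$ an $A$-fibered $G$-set such that all $G_x\in\mathcal G$ and $s$ a function on $X$ with $s(x)\in F(G_x)$ and ${}^gs(g^{-1}ax)=s(x)$ for all $g\in G,a\in A,x\in X$; morphisms $(X,s)\to(Y,t)$ are morphisms $\alpha:X\to Y$ of $A$-fibered $G$-sets with $G_x=G_{\alpha(x)}$, $t(\alpha(x))=s(x)$. $F_+(G)$ is the free abelian group on isomorphism classes $\{X,s\}$ modulo all $\{X\sqcup Y,s\sqcup t\}-\{X,s\}-\{Y,t\}$ and $\{X,s+r\}-\{X,s\}-\{X,r\}$; the coset of $\{X,s\}$ is $[X,s]$, and $r[X,s]=[X,rs]$ for $r\in R$. $\mathcal M'(G)=\{(K,\lambda):K\in\Sigma_{\mathcal G}(G),\lambda\in K^*\}$ with the order induced from $\mathcal M(G)$. For $(L,\psi)\in\mathcal M'(G)$ and $b\in F(L)$, $[L,\psi,b]\in F_+(G)$ is the class of $(X,s_b)$ where $X=(G\times A)/\{(l,\psi(l)^{-1}):l\in L\}$ and $s_b$ is the unique equivariant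 section with value $b$ at the base point. $F^+(G)\le\bigoplus_{(K,\lambda)\in\mathcal M'(G)}F(K)$ consists of the families with ${}^gx_{(K,\lambda)}=x_{({}^gK,{}^g\lambda)}$ for all $g\in G$. The maps. $m_{F,G}:F_+(G)\to F^+(G)$ is the $R$-linear map sending $[X,s]$ to $(a_{(L,\lambda)})$ with $a_{(L,\lambda)}=\sum F(\mathrm{Res}^{G_x}_L)(s(x))$, summed over $x$ in a set of representatives of the $A$-orbits of $X$ with $(L,\lambda)\le(G_x,\phi_x)$. $n_{F,G}:F^+(G)\to F_+(G)$ is $$n_{F,G}\big((a_{(K,\lambda)})\big)=\sum_{(L,\psi)\le(K,\lambda)\text{ in }\mathcal M'(G)}|L|\,\mu((L,\psi),(K,\lambda))\,[L,\psi,F(\mathrm{Res}^K_L)(a_{(K,\lambda)})],$$ where $\mu$ is the Möbius function of the poset $\mathcal M'(G)$. *)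

(* Defs.v *)
From HB Require Import structures.
From mathcomp Require Import all_boot all_algebra all_fingroup.
From mathcomp Require Import boolp classical_sets functions cardinality fsbigop.

(* Conventions.
   - The abelian group A is a zmodType, hence written additively: the product,
     inverse and unit of A are +, - and 0.
   - A finite group is a {group gT} for some gT : finGroupType, so a class of
     finite groups is a predicate on all {group gT}; it need not be closed under
     isomorphism. A subgroup of G : {group gT} is again a {group gT}, and a pair
     with group D : {group gT * hT} can be used for all G, H with D in G x H.
   - gKg^-1 is K :^ g^-1 in MathComp. *)

Set Implicit Arguments.
Unset Strict Implicit.
Unset Printing Implicit Defensive.

Import GRing.Theory.
Local Open Scope classical_set_scope.
Local Open Scope quotient_scope.
Local Open Scope ring_scope.

(* Formal linear combinations of elements of I; presmod below is the R-module
   with set of generators I and defining relations gen_rel. *)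
Inductive modterm (R : pzRingType) (I : Type) : Type :=
  | TGen of I
  | TZero
  | TAdd of modterm R I & modterm R I
  | TOpp of modterm R I
  | TScale of R & modterm R I.
Arguments TGen {R I}.
Arguments TZero {R I}.

HB.instance Definition _ (R : pzRingType) (I : Type) :=
  gen_eqMixin (modterm R I).
HB.instance Definition _ (R : pzRingType) (I : Type) :=
  gen_choiceMixin (modterm R I).

Section PresentedModule.
Variables (R : pzRingType) (I : Type).
Notation term := (modterm R I).
Variable gen_rel : term -> term -> Prop.

Inductive modeq : term -> term -> Prop :=
  | modeq_rel s t : gen_rel s t -> modeq s t
  | modeq_refl t : modeq t t
  | modeq_sym s t : modeq s t -> modeq t s
  | modeq_trans s t u : modeq s t -> modeq t u -> modeq s u
  | modeq_add s s' t t' :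
      modeq s s' -> modeq t t' -> modeq (TAdd s t) (TAdd s' t')
  | modeq_opp s s' : modeq s s' -> modeq (TOpp s) (TOpp s')
  | modeq_scale r s s' : modeq s s' -> modeq (TScale r s) (TScale r s')
  | modeq_addA s t u : modeq (TAdd s (TAdd t u)) (TAdd (TAdd s t) u)
  | modeq_addC s t : modeq (TAdd s t) (TAdd t s)
  | modeq_add0 t : modeq (TAdd TZero t) t
  | modeq_addN t : modeq (TAdd (TOpp t) t) TZero
  | modeq_scaleA q r t : modeq (TScale q (TScale r t)) (TScale (q * r) t)
  | modeq_scale1 t : modeq (TScale 1 t) t
  | modeq_scaleDr r s t :
      modeq (TScale r (TAdd s t)) (TAdd (TScale r s) (TScale r t))
  | modeq_scaleDl q r t :
      modeq (TScale (q + r) t) (TAdd (TScale q t) (TScale r t)).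

Definition modeqb : rel term := fun s t => `[< modeq s t >].

Lemma modeqb_equiv : equiv_class_of modeqb.
Proof.
split.
- by move=> t; apply/asboolP/modeq_refl.
- by move=> s t; apply/asboolP/asboolP => /modeq_sym.
- by move=> t s u /asboolP st /asboolP tu; apply/asboolP/(modeq_trans st).
Qed.

Canonical modeqb_rel := EquivRelPack modeqb_equiv.

Definition presmod := {eq_quot modeqb}.
HB.instance Definition _ := Choice.on presmod.
HB.instance Definition _ := EqQuotient.on presmod.

Lemma presmodP s t : modeq s t <-> \pi_presmod s = \pi_presmod t.
Proof.
split=> [st|/eqmodP/asboolP //]; exact/eqmodP/asboolP.
Qed.

Lemma modeq_repr t : modeq (generic_quotient.repr (\pi_presmod t)) t.
Proof. by apply/presmodP; rewrite reprK. Qed.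

Definition pm_zero : presmod := \pi_presmod TZero.
Definition pm_add (x y : presmod) : presmod := \pi_presmod (TAdd (generic_quotient.repr x) (generic_quotient.repr y)).
Definition pm_opp (x : presmod) : presmod := \pi_presmod (TOpp (generic_quotient.repr x)).
Definition pm_scale (r : R) (x : presmod) : presmod := \pi_presmod (TScale r (generic_quotient.repr x)).

Lemma pi_add s t : \pi_presmod (TAdd s t) = pm_add (\pi_presmod s) (\pi_presmod t).
Proof. by apply/presmodP/modeq_add; apply/modeq_sym/modeq_repr. Qed.
Lemma pi_opp t : \pi_presmod (TOpp t) = pm_opp (\pi_presmod t).
Proof. by apply/presmodP/modeq_opp; apply/modeq_sym/modeq_repr. Qed.
Lemma pi_scale r t : \pi_presmod (TScale r t) = pm_scale r (\pi_presmod t).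
Proof. by apply/presmodP/modeq_scale; apply/modeq_sym/modeq_repr. Qed.

Lemma pm_addA : associative pm_add.
Proof.
elim/quotW=> s; elim/quotW=> t; elim/quotW=> u.
rewrite -(pi_add t u) -(pi_add s t) -(pi_add s) -(pi_add _ u).
by apply/presmodP/modeq_addA.
Qed.
Lemma pm_addC : commutative pm_add.
Proof.
by elim/quotW=> s; elim/quotW=> t; rewrite -!pi_add; apply/presmodP/modeq_addC.
Qed.
Lemma pm_add0 : left_id pm_zero pm_add.
Proof. by elim/quotW=> s; rewrite -!pi_add; apply/presmodP/modeq_add0. Qed.
Lemma pm_addN : left_inverse pm_zero pm_opp pm_add.
Proof. by elim/quotW=> s; rewrite -pi_opp -pi_add; apply/presmodP/modeq_addN. Qed.

HB.instance Definition _ :=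
  GRing.isZmodule.Build presmod pm_addA pm_addC pm_add0 pm_addN.

Lemma pm_scaleA a b v : pm_scale a (pm_scale b v) = pm_scale (a * b) v.
Proof.
elim/quotW: v => v; rewrite -(pi_scale b v) -(pi_scale a) -(pi_scale _ v).
exact/presmodP/modeq_scaleA.
Qed.
Lemma pm_scale1 : left_id 1 pm_scale.
Proof. by elim/quotW=> v; rewrite -!pi_scale; apply/presmodP/modeq_scale1. Qed.
Lemma pm_scaleDr : right_distributive pm_scale +%R.
Proof.
move=> r; elim/quotW=> s; elim/quotW=> t.
rewrite -[LHS]/(pm_scale r (pm_add _ _)) -[RHS]/(pm_add _ _).
rewrite -(pi_add s t) -(pi_scale r s) -(pi_scale r t) -(pi_scale r) -pi_add.
exact/presmodP/modeq_scaleDr.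
Qed.
Lemma pm_scaleDl v : {morph pm_scale^~ v : a b / a + b}.
Proof.
move=> q r; elim/quotW: v => v.
rewrite -[RHS]/(pm_add _ _) -(pi_scale q) -(pi_scale r) -(pi_scale _ v) -pi_add.
exact/presmodP/modeq_scaleDl.
Qed.

HB.instance Definition _ := GRing.Zmodule_isLmodule.Build R presmod
  pm_scaleA pm_scale1 pm_scaleDr pm_scaleDl.

Fixpoint modeval (M : lmodType R) (f : I -> M) (t : term) : M :=
  match t with
  | TGen i => f i
  | TZero => 0
  | TAdd s t => modeval f s + modeval f t
  | TOpp t => - modeval f t
  | TScale r t => r *: modeval f t
  end.

Lemma modeval_eq (M : lmodType R) (f : I -> M) :
  (forall s t, gen_rel s t -> modeval f s = modeval f t) ->
  forall s t, modeq s t -> modeval f s = modeval f t.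
Proof.
move=> fP s t; elim=> //=.
- by move=> ? ? ? _ -> _ ->.
- by move=> ? ? ? ? _ -> _ ->.
- by move=> ? ? _ ->.
- by move=> ? ? ? _ ->.
- by move=> *; rewrite addrA.
- by move=> *; rewrite addrC.
- by move=> *; rewrite add0r.
- by move=> *; rewrite addNr.
- by move=> *; rewrite scalerA.
- by move=> *; rewrite scale1r.
- by move=> *; rewrite scalerDr.
- by move=> *; rewrite scalerDl.
Qed.

Lemma modevalD (M : lmodType R) (f g : I -> M) t :
  modeval (fun i => f i + g i) t = modeval f t + modeval g t.
Proof.
elim: t => //= [|s -> t ->|t ->|r t ->].
- by rewrite addr0.
- by rewrite addrACA.
- by rewrite opprD.
- by rewrite scalerDr.
Qed.

Definition pmgen (i : I) : presmod := \pi_presmod (TGen i).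

End PresentedModule.

Lemma modevalZ (R : comPzRingType) I (M : lmodType R) (f : I -> M) r t :
  modeval (fun i => r *: f i) t = r *: modeval f t.
Proof.
elim: t => //= [|s -> t ->|t ->|q t ->].
- by rewrite scaler0.
- by rewrite scalerDr.
- by rewrite scalerN.
- by rewrite !scalerA mulrC.
Qed.

Section Pairs.
Variables (A : zmodType) (gT : finGroupType).

(* A homomorphism K -> A is extended by 0 outside K, so that equality of pairs
   is Leibniz equality. *)
Definition is_char (K : {group gT}) (f : {ffun gT -> A}) : bool :=
  [forall x in K, forall y in K, f (x * y)%g == f x + f y]
  && [forall x, (x \notin K) ==> (f x == 0)].

Record mpair := MPair {
  mpair_val : {group gT} * {ffun gT -> A};
  _ : is_char mpair_val.1 mpair_val.2 }.
HB.instance Definition _ := [isSub for mpair_val].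
HB.instance Definition _ := [Choice of mpair by <:].

Definition mgrp (P : mpair) : {group gT} := (val P).1.
Definition mchar (P : mpair) : gT -> A := (val P).2.

Lemma mcharM P : {in mgrp P &, forall x y, mchar P (x * y)%g = mchar P x + mchar P y}.
Proof.
case: P => -[K f] i x y xK yK; have /andP[/= /forall_inP fM _] := i.
by have /forall_inP/(_ _ yK)/eqP := fM x xK.
Qed.

Lemma mchar1 P : mchar P 1%g = 0.
Proof.
have := mcharM (group1 (mgrp P)) (group1 (mgrp P)).
by rewrite mulg1 => /eqP; rewrite -subr_eq0 opprD addrA subrr sub0r oppr_eq0 => /eqP.
Qed.

Lemma mchar_out P x : x \notin mgrp P -> mchar P x = 0.
Proof.
by case: P => -[K f] i; have /andP[/= _ /forall_inP f0] := i => /f0/eqP.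
Qed.

Lemma mpair_eq P Q : mgrp P = mgrp Q -> mchar P =1 mchar Q -> P = Q.
Proof.
move: P Q => [[K f] /= hP] [[L g] /= hQ]; rewrite /mgrp /mchar /= => eKL efg.
by apply: val_inj => /=; congr pair => //; apply/ffunP.
Qed.

Lemma mkchar_proof (K : {group gT}) (f : gT -> A) :
  {in K &, forall x y, f (x * y)%g = f x + f y} ->
  is_char K [ffun x => if x \in K then f x else 0].
Proof.
move=> fM; apply/andP; split; last first.
  by apply/forall_inP => x xK; rewrite ffunE (negPf xK).
apply/forall_inP => x xK; apply/forall_inP => y yK.
by rewrite !ffunE groupM // xK yK fM.
Qed.

Definition mkpair (K : {group gT}) (f : gT -> A)
    (fM : {in K &, forall x y, f (x * y)%g = f x + f y}) : mpair :=
  @MPair (K, [ffun x => if x \in K then f x else 0]) (mkchar_proof fM).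

Lemma mgrp_mkpair K f fM : mgrp (@mkpair K f fM) = K.
Proof. by []. Qed.

Lemma mchar_mkpair (K : {group gT}) f fM x : x \in K -> mchar (@mkpair K f fM) x = f x.
Proof. by rewrite /mchar /= ffunE => ->. Qed.

Definition mple (P Q : mpair) : bool :=
  (mgrp P \subset mgrp Q) && [forall x in mgrp P, mchar P x == mchar Q x].

(* gKg^-1 *)
Definition lconjg (g : gT) (K : {group gT}) : {group gT} := (K :^ g^-1)%G.

Lemma mconj_proof (g : gT) (P : mpair) :
  {in lconjg g (mgrp P) &, forall x y,
    mchar P ((x * y) ^ g)%g = mchar P (x ^ g)%g + mchar P (y ^ g)%g}.
Proof.
by move=> x y; rewrite !mem_conjgV => xP yP; rewrite conjMg mcharM.
Qed.
Definition mconj (g : gT) (P : mpair) : mpair := mkpair (@mconj_proof g P).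

Lemma mtriv_proof (K : {group gT}) :
  {in K &, forall x y : gT, (fun=> 0 : A) (x * y)%g = 0 + 0}.
Proof. by move=> *; rewrite addr0. Qed.
Definition mtriv (K : {group gT}) : mpair := mkpair (@mtriv_proof K).

End Pairs.
Arguments mtriv A {gT} K.
Arguments mple {A gT}.

Section Products.
Variable A : zmodType.
Implicit Types gT hT kT : finGroupType.

Definition prodg gT hT (G : {group gT}) (H : {group hT}) : {group gT * hT} :=
  setX_group G H.

Lemma proj1_group_set gT hT (D : {group gT * hT}) :
  group_set [set g | [exists h, (g, h) \in D]]%SET.
Proof.
apply/group_setP; split=> [|x y]; rewrite !inE.
  by apply/existsP; exists 1%g; exact: group1.
move=> /existsP[h xh] /existsP[k yk]; apply/existsP; exists (h * k)%g.
exact: (groupM xh yk).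
Qed.
Definition proj1g gT hT (D : {group gT * hT}) := Group (proj1_group_set D).

Lemma proj2_group_set gT hT (D : {group gT * hT}) :
  group_set [set h | [exists g, (g, h) \in D]]%SET.
Proof.
apply/group_setP; split=> [|x y]; rewrite !inE.
  by apply/existsP; exists 1%g; exact: group1.
move=> /existsP[h xh] /existsP[k yk]; apply/existsP; exists (h * k)%g.
exact: (groupM xh yk).
Qed.
Definition proj2g gT hT (D : {group gT * hT}) := Group (proj2_group_set D).

Definition ker1 gT hT (D : {group gT * hT}) : {set gT} :=
  [set g | (g, 1%g) \in D]%SET.
Definition ker2 gT hT (D : {group gT * hT}) : {set hT} :=
  [set h | (1%g, h) \in D]%SET.

Definition char1 gT hT (P : mpair A (gT * hT)%type) (g : gT) : A :=
  mchar P (g, 1%g).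
Definition char2 gT hT (P : mpair A (gT * hT)%type) (h : hT) : A :=
  - mchar P (1%g, h).

Lemma star_group_set gT hT kT (D : {group gT * hT}) (V : {group hT * kT}) :
  group_set [set p : gT * kT |
    [exists h, ((p.1, h) \in D) && ((h, p.2) \in V)]]%SET.
Proof.
apply/group_setP; split=> [|x y]; rewrite !inE.
  by apply/existsP; exists 1%g; apply/andP; split; exact: group1.
move=> /existsP[h /andP[xh hx]] /existsP[k /andP[yk ky]].
apply/existsP; exists (h * k)%g.
by rewrite (groupM xh yk) (groupM hx ky).
Qed.
Definition starg gT hT kT (D : {group gT * hT}) (V : {group hT * kT}) :=
  Group (star_group_set D V).

Definition compat gT hT kT (P : mpair A (gT * hT)%type)
    (Q : mpair A (hT * kT)%type) : bool :=
  [forall h in ker2 (mgrp P) :&: ker1 (mgrp Q), char2 P h == char1 Q h].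

Definition star_char gT hT kT (P : mpair A (gT * hT)%type)
    (Q : mpair A (hT * kT)%type) (p : gT * kT) : A :=
  if [pick h | ((p.1, h) \in mgrp P) && ((h, p.2) \in mgrp Q)] is Some h
  then mchar P (p.1, h) + mchar Q (h, p.2) else 0.

Lemma star_charE gT hT kT (P : mpair A (gT * hT)%type)
    (Q : mpair A (hT * kT)%type) g h k : compat P Q ->
  (g, h) \in mgrp P -> (h, k) \in mgrp Q ->
  star_char P Q (g, k) = mchar P (g, h) + mchar Q (h, k).
Proof.
move=> /forall_inP PQ gh hk; rewrite /star_char /=.
case: pickP => [h' /= /andP[gh' h'k]|/(_ h)]; last by rewrite /= gh hk.
have dP : (1%g, h^-1 * h')%g \in mgrp P.
  have := groupM (groupVr gh) gh'.
  by rewrite -[(_ * _)%g]/(g^-1 * g, h^-1 * h')%g mulVg.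
have dQ : (h^-1 * h', 1)%g \in mgrp Q.
  have := groupM (groupVr hk) h'k.
  by rewrite -[(_ * _)%g]/(h^-1 * h', k^-1 * k)%g mulVg.
have /eqP e : char2 P (h^-1 * h')%g == char1 Q (h^-1 * h')%g.
  by apply: PQ; rewrite !inE dP dQ.
have -> : (g, h') = ((g, h) * (1, h^-1 * h'))%g.
  by rewrite -[RHS]/(g * 1, h * (h^-1 * h'))%g mulg1 mulKVg.
have -> : (h', k) = ((h, k) * (h^-1 * h', 1))%g.
  by rewrite -[RHS]/(h * (h^-1 * h'), k * 1)%g mulg1 mulKVg.
rewrite !mcharM //; move: e; rewrite /char1 /char2 => <-.
by rewrite addrACA subrr addr0.
Qed.

Lemma mstar_proof gT hT kT (P : mpair A (gT * hT)%type)
    (Q : mpair A (hT * kT)%type) :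
  {in starg (mgrp P) (mgrp Q) &, forall x y,
    (if compat P Q then star_char P Q (x * y)%g else 0) =
    (if compat P Q then star_char P Q x else 0) +
    (if compat P Q then star_char P Q y else 0)}.
Proof.
move=> [g k] [g' k']; rewrite !inE /=.
move=> /existsP[h /andP[xh hx]] /existsP[h' /andP[yk ky]].
case: ifP => // [PQ|_]; last by rewrite addr0.
rewrite (star_charE PQ xh hx) (star_charE PQ yk ky).
rewrite [((g, k) * _)%g](_ : _ = (g * g', k * k')%g) //.
rewrite (@star_charE _ _ _ _ _ _ (h * h')%g) //; last 2 first.
- exact: (groupM xh yk).
- exact: (groupM hx ky).
rewrite [(g * g', _)%g](_ : _ = (g, h) * (g', h'))%g //.
rewrite [(h * h', _)%g](_ : _ = (h, k) * (h', k'))%g //.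
by rewrite !mcharM // addrACA.
Qed.

(* Total: without compat P Q the character is set to 0. *)
Definition mstar gT hT kT (P : mpair A (gT * hT)%type)
    (Q : mpair A (hT * kT)%type) : mpair A (gT * kT)%type :=
  mkpair (@mstar_proof _ _ _ P Q).

Lemma starl_group_set gT hT (D : {group gT * hT}) (K : {group hT}) :
  group_set [set g | [exists k in K, (g, k) \in D]]%SET.
Proof.
apply/group_setP; split=> [|x y]; rewrite !inE.
  by apply/existsP; exists 1%g; apply/andP; split; exact: group1.
move=> /existsP[h /andP[xh hx]] /existsP[k /andP[yk ky]].
apply/existsP; exists (h * k)%g.
by rewrite (groupM xh yk) (groupM hx ky).
Qed.
Definition starl gT hT (D : {group gT * hT}) (K : {group hT}) :=
  Group (starl_group_set D K).

Lemma starr_group_set gT hT (K : {group gT}) (D : {group gT * hT}) :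
  group_set [set h | [exists k in K, (k, h) \in D]]%SET.
Proof.
apply/group_setP; split=> [|x y]; rewrite !inE.
  by apply/existsP; exists 1%g; apply/andP; split; exact: group1.
move=> /existsP[h /andP[xh hx]] /existsP[k /andP[yk ky]].
apply/existsP; exists (h * k)%g.
by rewrite (groupM xh yk) (groupM hx ky).
Qed.
Definition starr gT hT (K : {group gT}) (D : {group gT * hT}) :=
  Group (starr_group_set K D).

Lemma twist_group_set gT (g : gT) (L : {group gT}) :
  group_set [set (x ^ g^-1, x)%g | x in L]%SET.
Proof.
apply/group_setP; split=> [|_ _ /imsetP[x xL ->] /imsetP[y yL ->]].
  by apply/imsetP; exists 1%g; rewrite ?group1 // conj1g.
by apply/imsetP; exists (x * y)%g; rewrite ?groupM // conjMg.
Qed.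
(* {(glg^-1, l) : l in L} *)
Definition twistg gT (g : gT) (L : {group gT}) : {group gT * gT} :=
  Group (twist_group_set g L).

Lemma diag_group_set gT (K : {group gT}) : group_set [set (x, x) | x in K]%SET.
Proof.
apply/group_setP; split=> [|_ _ /imsetP[x xL ->] /imsetP[y yL ->]].
  by apply/imsetP; exists 1%g; rewrite ?group1.
by apply/imsetP; exists (x * y)%g; rewrite ?groupM.
Qed.
Definition diagg gT (K : {group gT}) : {group gT * gT} :=
  Group (diag_group_set K).

Definition mdiag gT (K : {group gT}) : mpair A (gT * gT)%type :=
  mtriv A (diagg K).

Lemma compat_diagr gT hT (P : mpair A (gT * hT)%type) (K : {group hT}) :
  compat P (mdiag K).
Proof.
apply/forall_inP => h; rewrite !inE => /andP[_ /imsetP[k kK [-> e]]].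
by rewrite /char2 /char1 -e !mchar1 oppr0.
Qed.

Lemma compat_diagl gT hT (P : mpair A (gT * hT)%type) (K : {group gT}) :
  compat (mdiag K) P.
Proof.
apply/forall_inP => h; rewrite !inE => /andP[/imsetP[k kK [e ->]] _].
by rewrite /char2 /char1 -e !mchar1 oppr0.
Qed.

End Products.
Arguments mdiag A {gT} K.

Section Fibered.
Variable A : zmodType.

(* An A-fibered G-set with carrier X: fact g a is the action of (g, a) in
   G x A; its values for g outside G are irrelevant. *)
Record fib (gT : finGroupType) (G : {group gT}) (X : Type) := Fib {
  fact : gT -> A -> X -> X;
  fact1 : forall x, fact 1%g 0 x = x;
  factM : forall g h a b x, g \in G -> h \in G ->
    fact (g * h)%g (a + b) x = fact g a (fact h b x);
  fact_free : forall a x, fact 1%g a x = x -> a = 0;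
  fact_fin : finite_set (range (fun x => range (fun a => fact 1%g a x))) }.

Section OneGroup.
Variables (gT : finGroupType) (G : {group gT}).

Section Basics.
Variables (X : Type) (U : fib G X).

Lemma fact_split g a x : g \in G -> fact U g a x = fact U 1%g a (fact U g 0 x).
Proof. by move=> gG; rewrite -factM // mul1g addr0. Qed.

Lemma factAC g a x : g \in G ->
  fact U g 0 (fact U 1%g a x) = fact U 1%g a (fact U g 0 x).
Proof. by move=> gG; rewrite -!factM // mul1g mulg1 addr0 add0r. Qed.

Lemma factA0 a b x : fact U 1%g (a + b) x = fact U 1%g a (fact U 1%g b x).
Proof. by rewrite -factM // mulg1. Qed.

Lemma factK g a x : g \in G -> fact U g a (fact U g^-1%g (- a) x) = x.
Proof. by move=> gG; rewrite -factM ?groupV // mulgV subrr fact1. Qed.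

Lemma factVK g a x : g \in G -> fact U g^-1%g (- a) (fact U g a x) = x.
Proof. by move=> gG; rewrite -factM ?groupV // mulVg addNr fact1. Qed.

Lemma factA_inj x : injective (fun a => fact U 1%g a x).
Proof.
move=> a b /= e; apply/subr0_eq/(@fact_free _ _ _ U _ x).
by rewrite addrC factA0 e -factA0 addNr fact1.
Qed.

Lemma stab_group_set x :
  group_set [set g in G | `[< exists a, fact U g 0 x = fact U 1%g a x >]]%SET.
Proof.
apply/group_setP; split=> [|g h].
  by rewrite inE group1; apply/asboolP; exists 0.
rewrite !inE => /andP[gG /asboolP[a ea]] /andP[hG /asboolP[b eb]].
rewrite groupM //; apply/asboolP; exists (b + a).
by rewrite -[0]addr0 factM // eb factAC // ea -factA0.
Qed.
Definition stab x : {group gT} := Group (stab_group_set x).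

Lemma stabP x g : reflect (g \in G /\ exists a, fact U g 0 x = fact U 1%g a x)
  (g \in stab x).
Proof.
rewrite inE; apply: (iffP andP) => -[gG e]; split=> //.
  exact: (asboolW e).
exact: asboolT.
Qed.

Definition stab_char x (g : gT) : A :=
  xget 0 [set a | fact U g 0 x = fact U 1%g a x].

Lemma stab_charE x g : g \in stab x ->
  fact U g 0 x = fact U 1%g (stab_char x g) x.
Proof.
move=> /stabP[_ [a ea]]; rewrite /stab_char.
by case: xgetP => [b _ //|/(_ a)].
Qed.

Lemma stab_char_proof x :
  {in stab x &, forall g h, stab_char x (g * h)%g = stab_char x g + stab_char x h}.
Proof.
move=> g h gS hS; apply: (@factA_inj x) => /=.
rewrite -stab_charE ?groupM //.
have [gG _] := stabP _ _ gS; have [hG _] := stabP _ _ hS.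
rewrite -[0]addr0 factM // (stab_charE hS) factAC // (stab_charE gS).
by rewrite -factA0 addrC.
Qed.
Definition stab_pair x : mpair A gT := mkpair (@stab_char_proof x).

End Basics.

Definition fib_mor X Y (U : fib G X) (V : fib G Y) (f : X -> Y) : Prop :=
  forall g a x, g \in G -> f (fact U g a x) = fact V g a (f x).

Definition fib_iso X Y (U : fib G X) (V : fib G Y) : Prop :=
  exists f f', [/\ fib_mor U V f, fib_mor V U f', cancel f f' & cancel f' f].

Section Sum.
Variables (X Y : Type) (U : fib G X) (V : fib G Y).

Definition sum_act g a (z : X + Y) : X + Y :=
  match z with inl x => inl (fact U g a x) | inr y => inr (fact V g a y) end.

Lemma sum_fin :
  finite_set (range (fun z => range (fun a => sum_act 1%g a z))).
Proof.
apply: (@sub_finite_set _ _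
 ((fun O : set X => inl @` O) @` range (fun x => range (fun a => fact U 1%g a x)) `|`
  (fun O : set Y => inr @` O) @` range (fun x => range (fun a => fact V 1%g a x)))).
  move=> _ [[x|y] _ <-]; [left|right].
    exists (range (fun a => fact U 1%g a x)); first by exists x.
    by rewrite image_comp.
  exists (range (fun a => fact V 1%g a y)); first by exists y.
  by rewrite image_comp.
by rewrite finite_setU; split; apply: finite_image; exact: fact_fin.
Qed.

Definition fib_sum : fib G (X + Y).
Proof.
refine (@Fib _ G (X + Y) sum_act _ _ _ sum_fin).
- by case=> x /=; rewrite fact1.
- by move=> g h a b [] x gG hG /=; rewrite factM.
- by move=> a [] x [] e; exact: (fact_free e).
Defined.
End Sum.

Lemma fib_reps X (U : fib G X) : exists n (r : 'I_n -> X),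
  forall x, exists! i, exists a, x = fact U 1%g a (r i).
Proof.
have /finite_setP[n] := fact_fin U.
move=> /card_set_bijP[f [fS fI fJ]]; pose orb x := range (fun a => fact U 1%g a x).
have [r rP] : {r : 'I_n -> X & forall i, f (orb (r i)) = i}.
  apply: (@choice _ _ (fun (i : 'I_n) x => f (orb x) = i :> nat)) => i.
  by have [_ [x _ <-] e] := fJ i (ltn_ord i); exists x.
have orbE x y : orb x = orb y -> exists a, x = fact U 1%g a y.
  move=> e; have : orb x x by exists 0 => //; rewrite fact1.
  by rewrite e => -[a _ <-]; exists a.
exists n, r => x.
have lt_n : (f (orb x) < n)%N by apply: fS; exists x.
exists (Ordinal lt_n); split.
  apply: orbE; apply: fI; rewrite ?inE; [by exists x|by eexists|].
  by rewrite rP.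
move=> i [a ea]; apply: val_inj => /=; rewrite -rP; congr f.
rewrite ea; apply/seteqP; split=> _ [b _ <-] /=.
  by exists (b + a) => //; rewrite factA0.
by exists (b - a) => //; rewrite -factA0 subrK.
Qed.

Section Transport.
Variables (X Y : Type) (U : fib G X) (f : Y -> X) (f' : X -> Y).
Hypotheses (fK : cancel f f') (f'K : cancel f' f).

Let tact g a y := f' (fact U g a (f y)).

Lemma transport_fin : finite_set (range (fun y => range (fun a => tact 1%g a y))).
Proof.
apply: (@sub_finite_set _ _
  ((fun O : set X => f' @` O) @` range (fun x => range (fun a => fact U 1%g a x)))).
  move=> _ [y _ <-]; exists (range (fun a => fact U 1%g a (f y))).
    by exists (f y).
  by rewrite image_comp.
by apply: finite_image; exact: fact_fin.
Qed.

Definition fib_transport : fib G Y.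
Proof.
refine (@Fib _ G Y tact _ _ _ transport_fin).
- by move=> x; rewrite /tact fact1.
- by move=> g h a b x gG hG; rewrite /tact f'K factM.
- by move=> a x e; apply: (fact_free (x := f x) (f := U)); apply: (can_inj f'K); rewrite fK.
Defined.

Lemma fib_transport_iso : fib_iso U fib_transport.
Proof.
exists f', f; split=> // g a x gG /=; rewrite /tact ?f'K //.
Qed.
End Transport.

Lemma fib_carrier X (U : fib G X) : exists n (f : 'I_n * A -> X) f',
  cancel f f' /\ cancel f' f.
Proof.
have [n [r rP]] := fib_reps U.
have [i iP] := choice rP.
have [a aP] := choice (fun x => (iP x).1).
exists n, (fun p => fact U 1%g p.2 (r p.1)), (fun x => (i x, a x)).
split=> [[j b] /=|x /=]; last by rewrite -aP.
set x := fact U _ b _.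
have ej : i x = j by apply: (iP x).2; exists b.
by rewrite ej; congr pair; apply: (@factA_inj _ U (r j)); rewrite /= -{1}ej -aP.
Qed.

(* By fib_small every A-fibered G-set has a copy carried by some 'I_n * A. These
   copies index the generators of the Grothendieck groups: carriers ranging over
   all of Type would put those groups in a universe above that of lmodType. *)
Definition sfib := {n & fib G ('I_n * A)}.

Lemma fib_small X (U : fib G X) : exists W : sfib, fib_iso U (tagged W).
Proof.
have [n [f [f' [fK f'K]]]] := fib_carrier U.
by exists (Tagged (fun n => fib G ('I_n * A)) (fib_transport U fK f'K)); exact: fib_transport_iso.
Qed.

Definition small X (U : fib G X) : sfib := sval (cid (fib_small U)).

End OneGroup.
End Fibered.

(* f on the subtype P, and the identity where f leaves P. *)
Definition try_map (T : Type) (P : T -> Prop) (f : T -> T) (x : {x | P x}) :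
    {x | P x} :=
  if pselect (P (f (sval x))) is left h then exist _ (f (sval x)) h else x.

Lemma try_mapE (T : Type) (P : T -> Prop) (f : T -> T) (x : {x | P x}) :
  P (f (sval x)) -> sval (try_map f x) = f (sval x).
Proof. by rewrite /try_map; case: pselect. Qed.

Lemma sval_inj (T : Type) (P : T -> Prop) : injective (@sval T P).
Proof. by case=> x px [y py] /= e; exact: eq_exist. Qed.

Section Transitive.
Variables (A : zmodType) (gT : finGroupType) (G : {group gT}) (P : mpair A gT).

(* The coset of (g, a) modulo {(l, phi(l)^-1) : l in D}, for P = (D, phi). *)
Definition pcoset (g : gT) (a : A) : set (gT * A) :=
  [set p | exists2 l, l \in mgrp P & p = ((g * l)%g, a - mchar P l)].

Definition ltrans (g : gT) (a : A) (C : set (gT * A)) : set (gT * A) :=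
  (fun p => ((g * p.1)%g, a + p.2)) @` C.

Lemma ltransE g a h b : ltrans g a (pcoset h b) = pcoset (g * h) (a + b).
Proof.
apply/seteqP; split=> [_ [_ [l lP ->] <-]|_ [l lP ->]] /=.
  by exists l => //; rewrite mulgA addrA.
exists (h * l, b - mchar P l)%g; first by exists l.
by rewrite /= mulgA addrA.
Qed.

Lemma ltransM g a h b C : ltrans g a (ltrans h b C) = ltrans (g * h) (a + b) C.
Proof.
rewrite /ltrans image_comp; congr (_ @` C).
by apply: funext => p /=; rewrite mulgA addrA.
Qed.

Lemma pcoset_refl g a : pcoset g a (g, a).
Proof. by exists 1%g; rewrite ?group1 // mulg1 mchar1 subr0. Qed.

Definition is_pcoset (C : set (gT * A)) : Prop :=
  exists g a, g \in G /\ C = pcoset g a.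

Definition orbcar := {C : set (gT * A) | is_pcoset C}.

Definition orb_act (g : gT) (a : A) : orbcar -> orbcar := try_map (ltrans g a).

Lemma orb_actE g a (C : orbcar) : g \in G ->
  sval (orb_act g a C) = ltrans g a (sval C).
Proof.
move=> gG; apply: try_mapE; have [h [b [hG ->]]] := svalP C.
by rewrite ltransE; exists (g * h)%g, (a + b); rewrite groupM.
Qed.

Lemma orb_fin : finite_set (range (fun C => range (fun a => orb_act 1%g a C))).
Proof.
apply: (@sub_finite_set _ _
  ((fun g => [set C : orbcar | exists a, sval C = pcoset g a]) @` [set: gT])).
  move=> _ [[C [g [a [gG eC]]]] _ <-]; exists g => //.
  apply/seteqP; split=> [[D dP] /= [b eD]|_ [b _ <-]] /=.
    exists (b - a) => //; apply: sval_inj; rewrite orb_actE ?group1 //= eC.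
    by rewrite ltransE mul1g subrK eD.
  by exists (b + a); rewrite orb_actE ?group1 //= eC ltransE mul1g.
by apply: finite_image; exact: finite_finset.
Qed.

Definition orbset : fib A G orbcar.
Proof.
refine (@Fib _ _ _ _ orb_act _ _ _ orb_fin).
- case=> C [g [a [gG eC]]]; apply: sval_inj.
  by rewrite orb_actE //= eC ltransE mul1g add0r.
- move=> g h a b C gG hG; apply: sval_inj.
  by rewrite !orb_actE ?groupM // ltransM.
- move=> a [C [g [b [gG eC]]]] /(congr1 sval); rewrite orb_actE //= eC ltransE.
  rewrite mul1g => e; have := pcoset_refl g b; rewrite -e => -[l lP [/esym el]].
  have -> : l = 1%g by apply: (mulgI g); rewrite mulg1.
  by rewrite mchar1 subr0 addrC -[X in X = _]addr0 => /addrI.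
Defined.

Definition orb_base : orbcar :=
  exist _ (pcoset 1 0) (ex_intro _ 1%g (ex_intro _ 0 (conj (group1 G) erefl))).

Lemma stab_base : mgrp P \subset G -> stab_pair orbset orb_base = P.
Proof.
move=> sPG; have eS g : g \in G -> forall a,
    fact orbset g 0 orb_base = fact orbset 1%g a orb_base <->
    g \in mgrp P /\ mchar P g = a.
  move=> gG a; split=> [/(congr1 sval)|[gP ea]].
    rewrite !orb_actE //= !ltransE mulg1 mul1g !addr0 => e.
    have := pcoset_refl g 0; rewrite e => -[l lP [-> /esym/eqP]].
    by rewrite mul1g subr_eq0 => /eqP ->.
  apply: sval_inj; rewrite !orb_actE //= !ltransE mulg1 mul1g !addr0.
  apply/seteqP; split=> [_ [l lP ->]|_ [l lP ->]].
    exists (g * l)%g; first exact: groupM.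
    by rewrite mul1g mcharM // ea opprD addrA subrr.
  exists (g^-1 * l)%g; first by rewrite groupM ?groupV.
  rewrite mulKVg mul1g sub0r; congr pair.
  have := mcharM gP (groupM (groupVr gP) lP); rewrite mulKVg ea => ->.
  by rewrite opprD addrA subrr sub0r.
have eG : stab orbset orb_base = mgrp P.
  apply/val_inj/setP => g; apply/stabP/idP => [[gG [a /eS]]|gP].
    by move=> /(_ gG) [].
  have gG := fintype.subsetP sPG g gP.
  by split=> //; exists (mchar P g); apply/eS.
apply: mpair_eq => // g; have [gS|gS] := boolP (g \in stab orbset orb_base).
  rewrite mchar_mkpair //; have := stab_charE gS.
  have gG : g \in G by rewrite (fintype.subsetP sPG) // -eG.
  by move=> /(eS g gG) [_ ->].
by rewrite !mchar_out //; rewrite -eG.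
Qed.

End Transitive.
Arguments orbset {A gT} G P.
Arguments orb_base {A gT} G P.

Section Tensor.
Variables (A : zmodType) (gT hT kT : finGroupType).
Variables (G : {group gT}) (H : {group hT}) (K : {group kT}) (X Y : Type).
Variables (U : fib A (prodg G H) X) (V : fib A (prodg H K) Y).

(* The (H x A)-orbit of (u, v). With g a u h b = ((g, h^-1), ab) u one has
   u (ha)^-1 = ((1, h), a^-1) u and h a v = ((h, 1), a) v. *)
Definition tens (u : X) (v : Y) : set (X * Y) :=
  [set p | exists h a, h \in H /\
     p = (fact U (1%g, h) (- a) u, fact V (h, 1%g) a v)].

(* (p, c) maps the class of (u, v) to that of (p.1 c u, v p.2^-1). *)
Definition tens_move (p : gT * kT) (c : A) (O : set (X * Y)) : set (X * Y) :=
  (fun w => (fact U (p.1, 1%g) c w.1, fact V (1%g, p.2) 0 w.2)) @` O.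

Definition is_tens (O : set (X * Y)) : Prop :=
  (exists u v, O = tens u v) /\ (forall c, tens_move 1%g c O = O -> c = 0).

Definition tenscar := {O : set (X * Y) | is_tens O}.

Definition tens_act (p : gT * kT) (c : A) : tenscar -> tenscar :=
  try_map (tens_move p c).

Let inX g h : g \in G -> h \in H -> (g, h) \in prodg G H.
Proof. by move=> gG hH; rewrite inE /= gG. Qed.
Let inY h k : h \in H -> k \in K -> (h, k) \in prodg H K.
Proof. by move=> gG hH; rewrite inE /= gG. Qed.

Let factXM g h g' h' a b u : g \in G -> h \in H -> g' \in G -> h' \in H ->
  fact U (g, h) a (fact U (g', h') b u) = fact U (g * g', h * h')%g (a + b) u.
Proof.
move=> gG hH gG' hH'.
by rewrite -[(g * g', _)%g]/((g, h) * (g', h'))%g (factM U) ?inX.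
Qed.
Let factYM g h g' h' a b u : g \in H -> h \in K -> g' \in H -> h' \in K ->
  fact V (g, h) a (fact V (g', h') b u) = fact V (g * g', h * h')%g (a + b) u.
Proof.
move=> gG hH gG' hH'.
by rewrite -[(g * g', _)%g]/((g, h) * (g', h'))%g (factM V) ?inY.
Qed.

Lemma tens_moveE g k c u v : g \in G -> k \in K ->
  tens_move (g, k) c (tens u v) =
  tens (fact U (g, 1%g) c u) (fact V (1%g, k) 0 v).
Proof.
move=> gG kK; apply/seteqP; split=> [_ [_ [h [a [hH ->]]] <-]|_ [h [a [hH ->]]]] /=.
  exists h, a; split=> //=.
  by rewrite !factXM // !factYM // !mulg1 !mul1g add0r addr0 addrC.
exists (fact U (1%g, h) (- a) u, fact V (h, 1%g) a v); first by exists h, a.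
by rewrite /= !factXM // !factYM // !mulg1 !mul1g add0r addr0 addrC.
Qed.

Lemma tens_moveM g k g' k' c c' O :
  g \in G -> k \in K -> g' \in G -> k' \in K ->
  tens_move (g, k) c (tens_move (g', k') c' O) =
  tens_move (g * g', k * k')%g (c + c') O.
Proof.
move=> gG kK gG' kK'; rewrite /tens_move image_comp; congr (_ @` O).
by apply: funext => w /=; rewrite factXM // factYM // !mulg1 addr0.
Qed.

Lemma tens_move1 O : tens_move 1%g 0 O = O.
Proof.
rewrite /tens_move -[RHS]image_id; congr (_ @` O).
by apply: funext => -[u v] /=; rewrite (fact1 U) (fact1 V).
Qed.

Lemma tens_actE p c (O : tenscar) : p \in prodg G K ->
  sval (tens_act p c O) = tens_move p c (sval O).
Proof.
case: p => g k; rewrite inE /= => /andP[gG kK].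
apply: try_mapE; have [[u [v ->]] fr] := svalP O.
split; first by rewrite tens_moveE //; eexists; eexists.
move=> d; rewrite -[1%g]/(1%g, 1%g) tens_moveM //.
move=> /(congr1 (tens_move (g^-1, k^-1)%g (- c))).
rewrite !tens_moveM ?groupM ?groupV // !mul1g !mulVg addNr tens_move1.
by rewrite [d + c]addrC addKr => /fr.
Qed.

Lemma tensA a b u v :
  tens (fact U 1%g a u) (fact V 1%g b v) = tens (fact U 1%g (a + b) u) v.
Proof.
have one (T T' : finGroupType) : 1%g = (1%g, 1%g) :> T * T' by [].
apply/seteqP; split=> [_ [h [c [hH ->]]]|_ [h [c [hH ->]]]] /=; rewrite !one.
  exists h, (b + c); split=> //.
  rewrite !factXM // !factYM // !mulg1 [c + b]addrC; congr (fact U _ _ _, _).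
  by rewrite opprD [a + b]addrC addrACA addNr add0r.
exists h, (c - b); split=> //.
rewrite !factXM // !factYM // !mulg1 subrK; congr (fact U _ _ _, _).
by rewrite opprB [b - c]addrC -addrA [b + a]addrC.
Qed.

Lemma tens_fin :
  finite_set (range (fun O => range (fun a => tens_act 1%g a O))).
Proof.
pose F (p : set X * set Y) : set tenscar :=
  [set C | exists u v, [/\ p.1 u, p.2 v & sval C = tens u v]].
apply: (@sub_finite_set _ _
  (F @` (range (fun x => range (fun a => fact U 1%g a x)) `*`
         range (fun x => range (fun a => fact V 1%g a x))))).
  move=> _ [[C [[u [v eC]] fr]] _ <-].
  exists (range (fun a => fact U 1%g a u), range (fun a => fact V 1%g a v)).
    by split=> /=; eexists.
  have one (T T' : finGroupType) : 1%g = (1%g, 1%g) :> T * T' by [].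
  apply/seteqP; split=> [D [u' [v' [/= [a _ <-] [b _ <-] eD]]]|_ [b _ <-]] /=.
    exists (a + b) => //; apply: sval_inj; rewrite tens_actE ?group1 //= eC eD.
    by rewrite tensA one tens_moveE // (fact1 V).
  exists (fact U 1%g b u), v; split; first by exists b.
    by exists 0 => //; rewrite (fact1 V).
  by rewrite tens_actE ?group1 //= eC one tens_moveE // (fact1 V).
by apply: finite_image; apply: finite_setX; exact: fact_fin.
Qed.

Definition tensor : fib A (prodg G K) tenscar.
Proof.
refine (@Fib _ _ _ _ tens_act _ _ _ tens_fin).
- by move=> O; apply: sval_inj; rewrite tens_actE ?group1 // tens_move1.
- move=> [g k] [g' k'] a b O p q; apply: sval_inj.
  rewrite !tens_actE ?groupM //; move: p q.
  rewrite !inE /= => /andP[gG kK] /andP[gG' kK'].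
  by rewrite tens_moveM.
- move=> a O /(congr1 sval); rewrite tens_actE ?group1 // => e.
  by case: (svalP O) => _; apply.
Defined.

End Tensor.

Section FibIso.
Variables (A : zmodType) (gT : finGroupType) (G : {group gT}).

Lemma fib_iso_refl X (U : fib A G X) : fib_iso U U.
Proof. by exists id, id. Qed.

Lemma fib_iso_sym X Y (U : fib A G X) (V : fib A G Y) :
  fib_iso U V -> fib_iso V U.
Proof. by move=> [f [f' [? ? ? ?]]]; exists f', f. Qed.

Lemma fib_iso_trans X Y Z (U : fib A G X) (V : fib A G Y) (W : fib A G Z) :
  fib_iso U V -> fib_iso V W -> fib_iso U W.
Proof.
move=> [f [f' [fm f'm fK f'K]]] [h [h' [hm h'm hK h'K]]].
exists (h \o f), (f' \o h'); split.
- by move=> g a x gG /=; rewrite fm // hm.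
- by move=> g a x gG /=; rewrite h'm // f'm.
- exact: can_comp hK fK.
- exact: can_comp f'K h'K.
Qed.

Lemma fib_iso_bij X Y (U : fib A G X) (V : fib A G Y) (f : X -> Y) :
  fib_mor U V f -> injective f -> (forall y, exists x, f x = y) -> fib_iso U V.
Proof.
move=> fm fI fJ; have [f' f'K] := choice fJ.
have fK : cancel f f' by move=> x; apply: fI; rewrite f'K.
by exists f, f'; split=> // g a y gG; apply: fI; rewrite fm // !f'K.
Qed.

Lemma fib_iso_sum X X' Y Y' (U : fib A G X) (U' : fib A G X')
    (V : fib A G Y) (V' : fib A G Y') :
  fib_iso U U' -> fib_iso V V' -> fib_iso (fib_sum U V) (fib_sum U' V').
Proof.
move=> [f [f' [fm f'm fK f'K]]] [h [h' [hm h'm hK h'K]]].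
exists (fun z => match z with inl x => inl (f x) | inr y => inr (h y) end).
exists (fun z => match z with inl x => inl (f' x) | inr y => inr (h' y) end).
split=> [g a [] x gG|g a [] x gG|[] x|[] x] /=;
  by rewrite ?fm ?hm ?f'm ?h'm ?fK ?hK ?f'K ?h'K.
Qed.

Lemma smallP X (U : fib A G X) : fib_iso U (tagged (small U)).
Proof. exact: (svalP (cid (fib_small U))). Qed.

End FibIso.

Section TensorMap.
Variables (A : zmodType) (gT hT kT : finGroupType).
Variables (G : {group gT}) (H : {group hT}) (K : {group kT}).
Variables (X X' Y Y' : Type).
Variables (U : fib A (prodg G H) X) (U' : fib A (prodg G H) X').
Variables (V : fib A (prodg H K) Y) (V' : fib A (prodg H K) Y').
Variables (f : X -> X') (h : Y -> Y').
Hypotheses (fm : fib_mor U U' f) (fI : injective f).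
Hypotheses (hm : fib_mor V V' h) (hI : injective h).

Let fh (w : X * Y) := (f w.1, h w.2).

Lemma fh_inj : injective fh.
Proof. by move=> [u v] [u' v'] [/fI -> /hI ->]. Qed.

Lemma tens_img u v : fh @` tens U V u v = tens U' V' (f u) (h v).
Proof.
apply/seteqP; split=> [_ [_ [k [a [kH ->]]] <-]|_ [k [a [kH ->]]]] /=.
  by exists k, a; rewrite /fh /= fm ?hm // inE /= ?group1 ?kH.
exists (fact U (1%g, k) (- a) u, fact V (k, 1%g) a v); first by exists k, a.
by rewrite /fh /= fm ?hm // inE /= ?group1 ?kH.
Qed.

Lemma move_img p c (O : set (X * Y)) : p \in prodg G K ->
  fh @` tens_move U V p c O = tens_move U' V' p c (fh @` O).
Proof.
case: p => g k; rewrite inE /= => /andP[gG kK].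
rewrite /tens_move !image_comp; congr (_ @` O); apply: funext => w /=.
by rewrite /fh /= fm ?hm // inE /= ?group1 ?gG.
Qed.

Lemma img_inj (O O' : set (X * Y)) : fh @` O = fh @` O' -> O = O'.
Proof.
have sub B C : fh @` B = fh @` C -> B `<=` C.
  move=> e w Bw; have : (fh @` B) (fh w) by exists w.
  by rewrite e => -[w' Cw' /fh_inj <-].
by move=> e; apply/seteqP; split; apply: sub.
Qed.

Lemma is_tens_img u v :
  is_tens U V (tens U V u v) <-> is_tens U' V' (tens U' V' (f u) (h v)).
Proof.
split=> -[_ fr]; split; do ?by eexists; eexists.
  move=> c; rewrite -tens_img -move_img ?group1 // => /img_inj; exact: fr.
by move=> c e; apply: fr; rewrite -tens_img -move_img ?group1 // e.
Qed.

Lemma tens_map_proof (O : tenscar U V) : is_tens U' V' (fh @` sval O).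
Proof.
by case: (svalP O) => -[u [v e]]; move: (svalP O); rewrite e tens_img => /is_tens_img.
Qed.

Definition tens_map (O : tenscar U V) : tenscar U' V' :=
  exist _ (fh @` sval O) (tens_map_proof O).

Lemma tens_map_mor : fib_mor (tensor U V) (tensor U' V') tens_map.
Proof.
by move=> p c O pG; apply: sval_inj; rewrite /= !tens_actE //= move_img.
Qed.

Lemma tens_map_inj : injective tens_map.
Proof. by move=> O O' /(congr1 sval) /img_inj /sval_inj. Qed.

Lemma tens_map_surj u v (O : tenscar U' V') :
  sval O = tens U' V' (f u) (h v) -> exists O', tens_map O' = O.
Proof.
move=> e; have uv : is_tens U V (tens U V u v).
  by apply/is_tens_img; rewrite -e; exact: svalP.
exists (exist _ _ uv); apply: sval_inj => /=; by rewrite tens_img e.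
Qed.

End TensorMap.

Section TensorIso.
Variables (A : zmodType) (gT hT kT : finGroupType).
Variables (G : {group gT}) (H : {group hT}) (K : {group kT}).

Lemma tensor_iso X X' Y Y'
    (U : fib A (prodg G H) X) (U' : fib A (prodg G H) X')
    (V : fib A (prodg H K) Y) (V' : fib A (prodg H K) Y') :
  fib_iso U U' -> fib_iso V V' -> fib_iso (tensor U V) (tensor U' V').
Proof.
move=> [f [f' [fm f'm fK f'K]]] [h [h' [hm h'm hK h'K]]].
apply: (fib_iso_bij (tens_map_mor fm (can_inj fK) hm (can_inj hK))).
  exact: tens_map_inj.
move=> O; have [[u [v e]] _] := svalP O.
by apply: (@tens_map_surj _ _ _ _ _ _ _ _ _ _ _ _ _ _ _ _ _ _ _ _ _ (f' u) (h' v)); rewrite f'K h'K.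
Qed.

Lemma tensor_suml X X' Y (U : fib A (prodg G H) X) (U' : fib A (prodg G H) X')
    (V : fib A (prodg H K) Y) :
  fib_iso (tensor (fib_sum U U') V) (fib_sum (tensor U V) (tensor U' V)).
Proof.
apply: fib_iso_sym.
have lm : fib_mor U (fib_sum U U') inl by [].
have rm : fib_mor U' (fib_sum U U') inr by [].
have im : fib_mor V V id by [].
have lI : injective (@inl X X') by move=> ? ? [].
have rI : injective (@inr X X') by move=> ? ? [].
have iI : injective (@id Y) by [].
pose F (z : tenscar U V + tenscar U' V) : tenscar (fib_sum U U') V :=
  match z with inl o => tens_map lm lI im iI o | inr o => tens_map rm rI im iI o end.
apply: (@fib_iso_bij _ _ _ _ _ _ _ F).
- by move=> p c [] O pG; exact: tens_map_mor.
- have neq (O : tenscar U V) (O' : tenscar U' V) :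
      tens_map lm lI im iI O <> tens_map rm rI im iI O'.
    move=> /(congr1 sval) /= e; have [[u [v eO]] _] := svalP O.
    have : (fun w => (@inl X X' w.1, w.2)) @` sval O `<=`
           (fun w => (inr w.1, w.2)) @` sval O' by rewrite e.
    move=> /(_ (inl u, v)) [|[? ?] _ //]; exists (u, v) => //.
    rewrite eO; exists 1%g, 0; split=> //.
    by rewrite oppr0 (fact1 U) (fact1 V).
  move=> [O|O] [O'|O'] /=.
  + by move=> /tens_map_inj ->.
  + by move=> /neq.
  + by move=> /esym /neq.
  + by move=> /tens_map_inj ->.
- move=> O; have [[[u|u] [v e]] _] := svalP O.
    have [O' <-] := @tens_map_surj _ _ _ _ _ _ _ _ _ _ _ _ _ _ _ _ _ lm lI im iI u v O e.
    by exists (inl O').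
  have [O' <-] := @tens_map_surj _ _ _ _ _ _ _ _ _ _ _ _ _ _ _ _ _ rm rI im iI u v O e.
  by exists (inr O').
Qed.

Lemma tensor_sumr X Y Y' (U : fib A (prodg G H) X)
    (V : fib A (prodg H K) Y) (V' : fib A (prodg H K) Y') :
  fib_iso (tensor U (fib_sum V V')) (fib_sum (tensor U V) (tensor U V')).
Proof.
apply: fib_iso_sym.
have lm : fib_mor V (fib_sum V V') inl by [].
have rm : fib_mor V' (fib_sum V V') inr by [].
have im : fib_mor U U id by [].
have lI : injective (@inl Y Y') by move=> ? ? [].
have rI : injective (@inr Y Y') by move=> ? ? [].
have iI : injective (@id X) by [].
pose F (z : tenscar U V + tenscar U V') : tenscar U (fib_sum V V') :=
  match z with inl o => tens_map im iI lm lI o | inr o => tens_map im iI rm rI o end.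
apply: (@fib_iso_bij _ _ _ _ _ _ _ F).
- by move=> p c [] O pG; exact: tens_map_mor.
- have neq (O : tenscar U V) (O' : tenscar U V') :
      tens_map im iI lm lI O <> tens_map im iI rm rI O'.
    move=> /(congr1 sval) /= e; have [[u [v eO]] _] := svalP O.
    have : (fun w => (w.1, @inl Y Y' w.2)) @` sval O `<=`
           (fun w => (w.1, inr w.2)) @` sval O' by rewrite e.
    move=> /(_ (u, inl v)) [|[? ?] _ //]; exists (u, v) => //.
    rewrite eO; exists 1%g, 0; split=> //.
    by rewrite oppr0 (fact1 U) (fact1 V).
  move=> [O|O] [O'|O'] /=.
  + by move=> /tens_map_inj ->.
  + by move=> /neq.
  + by move=> /esym /neq.
  + by move=> /tens_map_inj ->.
- move=> O; have [[u [[v|v] e]] _] := svalP O.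
    have [O' <-] := @tens_map_surj _ _ _ _ _ _ _ _ _ _ _ _ _ _ _ _ _ im iI lm lI u v O e.
    by exists (inl O').
  have [O' <-] := @tens_map_surj _ _ _ _ _ _ _ _ _ _ _ _ _ _ _ _ _ im iI rm rI u v O e.
  by exists (inr O').
Qed.

End TensorIso.

Section Burnside.
Variables (A : zmodType) (R : comPzRingType).

Section OneGroup.
Variables (gT : finGroupType) (G : {group gT}).

(* burn is R tensored with the Grothendieck group, presented over R by the
   generators and relations of that group. *)
Inductive burn_rel : modterm R (sfib A G) -> modterm R (sfib A G) -> Prop :=
  | burn_iso U V : fib_iso (tagged U) (tagged V) -> burn_rel (TGen U) (TGen V)
  | burn_sum U V W : fib_iso (tagged W) (fib_sum (tagged U) (tagged V)) ->
      burn_rel (TGen W) (TAdd (TGen U) (TGen V)).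

Definition burn := presmod burn_rel.
HB.instance Definition _ := GRing.Lmodule.on burn.

Definition fclass X (U : fib A G X) : burn := pmgen burn_rel (small U).

Lemma fclass_iso X Y (U : fib A G X) (V : fib A G Y) :
  fib_iso U V -> fclass U = fclass V.
Proof.
move=> UV; apply/presmodP/modeq_rel/burn_iso.
apply: fib_iso_trans (fib_iso_sym (smallP U)) _.
exact: fib_iso_trans UV (smallP V).
Qed.

Lemma fclass_sum X Y (U : fib A G X) (V : fib A G Y) :
  fclass (fib_sum U V) = fclass U + fclass V.
Proof.
rewrite -[RHS]/(pm_add _ _) -pi_add; apply/presmodP/modeq_rel/burn_sum.
apply: fib_iso_trans (fib_iso_sym (smallP _)) _.
by apply: fib_iso_sum; exact: smallP.
Qed.

Lemma fclass_small (U : sfib A G) : fclass (tagged U) = pmgen burn_rel U.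
Proof. by apply/presmodP/modeq_rel/burn_iso/fib_iso_sym/smallP. Qed.

End OneGroup.

Section Composition.
Variables (gT hT kT : finGroupType).
Variables (G : {group gT}) (H : {group hT}) (K : {group kT}).

(* The bilinear extension of the tensor product; see bcomp_class, bcompDl,
   bcompZl, bcompDr, bcompZr. *)
Definition bcomp (x : burn (prodg G H)) (y : burn (prodg H K)) :
    burn (prodg G K) :=
  modeval (fun U => modeval (fun V => fclass (tensor (tagged U) (tagged V)))
    (generic_quotient.repr y)) (generic_quotient.repr x).

Let tens_gen (t : modterm R (sfib A (prodg H K))) (U : sfib A (prodg G H)) :
    burn (prodg G K) :=
  modeval (fun V => fclass (tensor (tagged U) (tagged V))) t.

Lemma bcomp_pi s t :
  bcomp (\pi_(burn (prodg G H)) s) (\pi_(burn (prodg H K)) t) =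
  modeval (fun U => modeval (fun V => fclass (tensor (tagged U) (tagged V))) t) s.
Proof.
rewrite /bcomp -/(tens_gen _) -/(tens_gen t).
have -> : tens_gen (generic_quotient.repr (\pi_(burn (prodg H K)) t)) = tens_gen t.
  apply: funext => U.
  apply: (modeval_eq (gen_rel := @burn_rel _ (prodg H K))); last exact: modeq_repr.
  move=> _ _ [V V' VV'|V V' W VW] /=.
    exact: fclass_iso (tensor_iso (fib_iso_refl _) VV').
  rewrite -fclass_sum; apply: fclass_iso.
  exact: fib_iso_trans (tensor_iso (fib_iso_refl _) VW) (tensor_sumr _ _ _).
apply: (modeval_eq (gen_rel := @burn_rel _ (prodg G H))); last exact: modeq_repr.
move=> _ _ [U U' UU'|U U' W UW] /=; rewrite /tens_gen.
  congr (modeval _ t); apply: funext => V.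
  exact: fclass_iso (tensor_iso UU' (fib_iso_refl _)).
rewrite -modevalD; congr (modeval _ t); apply: funext => V /=.
rewrite -fclass_sum; apply: fclass_iso.
exact: fib_iso_trans (tensor_iso UW (fib_iso_refl _)) (tensor_suml _ _ _).
Qed.

Lemma bcompDl x x' y : bcomp (x + x') y = bcomp x y + bcomp x' y.
Proof.
rewrite -[x]reprK -[x']reprK -[y]reprK -[_ + _]pi_add.
by rewrite !(bcomp_pi _ (generic_quotient.repr y)).
Qed.

Lemma bcompZl r x y : bcomp (r *: x) y = r *: bcomp x y.
Proof.
rewrite -[x]reprK -[y]reprK -[r *: _]pi_scale.
by rewrite !(bcomp_pi _ (generic_quotient.repr y)).
Qed.

Lemma bcompDr x y y' : bcomp x (y + y') = bcomp x y + bcomp x y'.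
Proof.
rewrite -[x]reprK -[y]reprK -[y']reprK -[_ + _]pi_add.
by rewrite !(bcomp_pi (generic_quotient.repr x)) modevalD.
Qed.

Lemma bcompZr r x y : bcomp x (r *: y) = r *: bcomp x y.
Proof.
rewrite -[x]reprK -[y]reprK -[r *: _]pi_scale.
by rewrite !(bcomp_pi (generic_quotient.repr x)) modevalZ.
Qed.

Lemma bcomp_class X Y (U : fib A (prodg G H) X) (V : fib A (prodg H K) Y) :
  bcomp (fclass U) (fclass V) = fclass (tensor U V).
Proof.
rewrite /fclass bcomp_pi /=; apply: fclass_iso; apply: fib_iso_sym.
by apply: tensor_iso; exact: smallP.
Qed.

End Composition.
End Burnside.

Definition grpclass := forall gT : finGroupType, {group gT} -> Prop.

Definition pairfamily (A : zmodType) := forall gT hT : finGroupType,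
  {group gT} -> {group hT} -> mpair A (gT * hT)%type -> Prop.

Section Data.
Variables (A : zmodType) (GG : grpclass) (S : pairfamily A).

Definition Sigma (gT : finGroupType) (G H : {group gT}) : Prop :=
  H \subset G /\ GG H.

Definition family_on : Prop :=
  forall (gT hT : finGroupType) (G : {group gT}) (H : {group hT}) P,
    GG G -> GG H -> S G H P -> mgrp P \subset prodg G H.

Definition axiom_i : Prop :=
  forall (gT : finGroupType) (G : {group gT}), GG G -> S G G (mdiag A G).

Definition axiom_ii : Prop :=
  forall (gT hT : finGroupType) (G : {group gT}) (H : {group hT}) P x,
    GG G -> GG H -> S G H P -> x \in prodg G H -> S G H (mconj x P).

Definition axiom_iii : Prop :=
  forall (gT hT kT : finGroupType)
    (G : {group gT}) (H : {group hT}) (K : {group kT}) P Q,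
    GG G -> GG H -> GG K -> S G H P -> S H K Q -> compat P Q ->
    S G K (mstar P Q).

Definition axiom_iv : Prop :=
  forall (gT hT : finGroupType) (G : {group gT}) (H : {group hT}) P K,
    GG G -> GG H -> S G H P -> Sigma H K ->
    GG (starl (mgrp P) K) /\ S (starl (mgrp P) K) K (mstar P (mdiag A K)).

Definition axiom_vi : Prop :=
  forall (gT : finGroupType) (G H : {group gT}),
    GG G -> Sigma G H -> S H G (mdiag A H).

Definition axiom_vii : Prop :=
  forall (gT hT : finGroupType) (G : {group gT}) (H : {group hT}) P,
    GG G -> GG H -> S G H P ->
    GG (proj2g (mgrp P)) /\
    forall K, Sigma (proj2g (mgrp P)) K ->
      GG (starl (mgrp P) K) /\ S (starl (mgrp P) K) K (mstar P (mdiag A K)).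

Definition axiom_viii : Prop :=
  forall (gT hT : finGroupType) (G : {group gT}) (H : {group hT}) P,
    GG G -> GG H -> S G H P ->
    GG (proj1g (mgrp P)) /\
    forall K, Sigma (proj1g (mgrp P)) K ->
      GG (starr K (mgrp P)) /\ S K (starr K (mgrp P)) (mstar (mdiag A K) P).

Variable R : comPzRingType.

(* Morphisms from H to G. *)
Definition homD (gT hT : finGroupType) (G : {group gT}) (H : {group hT})
    (f : burn A R (prodg G H)) : Prop :=
  exists n (c : 'I_n -> R) (P : 'I_n -> mpair A (gT * hT)%type),
    (forall i, S G H (P i)) /\
    f = \sum_(i < n) c i *: fclass R (orbset (prodg G H) (P i)).

(* An R-linear functor on the subcategory with objects GG and morphisms homD.
   The values at groups outside GG and at elements outside homD play no role. *)
Record functorD := FunctorD {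
  fobj : forall gT : finGroupType, {group gT} -> lmodType R;
  fmap : forall (gT hT : finGroupType) (G : {group gT}) (H : {group hT}),
    burn A R (prodg G H) -> {linear fobj H -> fobj G};
  fmap_linear : forall (gT hT : finGroupType) (G : {group gT}) (H : {group hT})
    (r : R) (f g : burn A R (prodg G H)) v,
    GG G -> GG H -> homD f -> homD g ->
    fmap (r *: f + g) v = r *: fmap f v + fmap g v;
  fmap_id : forall (gT : finGroupType) (G : {group gT}) v, GG G ->
    fmap (fclass R (orbset (prodg G G) (mdiag A G))) v = v;
  fmap_comp : forall (gT hT kT : finGroupType)
    (G : {group gT}) (H : {group hT}) (K : {group kT})
    (f : burn A R (prodg G H)) (g : burn A R (prodg H K)) v,
    GG G -> GG H -> GG K -> homD f -> homD g ->
    fmap (bcomp f g) v = fmap f (fmap g v) }.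

Variable F : functorD.

Definition resF (gT : finGroupType) (L K : {group gT}) :
    {linear fobj F K -> fobj F L} :=
  fmap F (fclass R (orbset (prodg L K) (mdiag A L))).

Definition conjF (gT : finGroupType) (g : gT) (L : {group gT}) :
    {linear fobj F L -> fobj F (lconjg g L)} :=
  fmap F (fclass R (orbset (prodg (lconjg g L) L) (mtriv A (twistg g L)))).

(* atF v = atF w, for v in F(K) and w in F(L), says that K = L and v = w. *)
Definition atF (gT : finGroupType) (K : {group gT}) (v : fobj F K) :
  {L : {group gT} & fobj F L} := existT (fun L : {group gT} => fobj F L : Type) K v.

Section OneGroup.
Variables (gT : finGroupType) (G : {group gT}).

Lemma atF_inj (K : {group gT}) : injective (@atF gT K).
Proof.
move=> v w e; rewrite -[RHS](projT2_eq e) /=.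
by rewrite (Prop_irrelevance (projT1_eq e) erefl).
Qed.

Lemma atF_add K L v v' w w' : @atF gT K v = @atF gT L w -> atF v' = atF w' ->
  atF (v + v') = atF (w + w').
Proof.
move=> e; have eKL : K = L := congr1 tag e.
by case: L / eKL w w' e => w w' /atF_inj -> /atF_inj ->.
Qed.

Lemma atF_map (f : forall K : {group gT}, fobj F K -> fobj F K) K L v w :
  @atF gT K v = @atF gT L w -> atF (f K v) = atF (f L w).
Proof.
exact: (congr1 (fun z : {K : {group gT} & fobj F K} => atF (f (tag z) (tagged z)))).
Qed.

Lemma atF_conj g K L v w :
  @atF gT K v = @atF gT L w -> atF (conjF g K v) = atF (conjF g L w).
Proof.
exact: (congr1 (fun z : {K : {group gT} & fobj F K} => atF (conjF g _ (tagged z)))).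
Qed.

Definition castF (K L : {group gT}) (e : K = L) (v : fobj F K) : fobj F L :=
  eq_rect K (fun M : {group gT} => fobj F M) v L e.

Lemma atF_cast K L (e : K = L) v : atF (castF e v) = atF v.
Proof. by case: L / e. Qed.

Definition is_section X (U : fib A G X) (s : forall x, fobj F (stab U x)) : Prop :=
  forall g a x, g \in G -> atF (conjF g _ (s (fact U g^-1%g a x))) = atF (s x).

Record gobj (X : Type) := GObj {
  gfib : fib A G X;
  gsec : forall x, fobj F (stab gfib x);
  gobj_GG : forall x, GG (stab gfib x);
  gobj_sec : is_section gsec }.

Definition gmor X Y (o : gobj X) (o' : gobj Y) (f : X -> Y) : Prop :=
  fib_mor (gfib o) (gfib o') f /\ forall x, atF (gsec o' (f x)) = atF (gsec o x).

Definition giso X Y (o : gobj X) (o' : gobj Y) : Prop :=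
  exists f f', [/\ gmor o o' f, gmor o' o f', cancel f f' & cancel f' f].

Lemma giso_refl X (o : gobj X) : giso o o.
Proof. by exists id, id. Qed.

Lemma giso_sym X Y (o : gobj X) (o' : gobj Y) : giso o o' -> giso o' o.
Proof. by move=> [f [f' [? ? ? ?]]]; exists f', f. Qed.

Lemma giso_trans X Y Z (o : gobj X) (o' : gobj Y) (o'' : gobj Z) :
  giso o o' -> giso o' o'' -> giso o o''.
Proof.
move=> [f [f' [[fm fs] [f'm f's] fK f'K]]] [h [h' [[hm hs] [h'm h's] hK h'K]]].
exists (h \o f), (f' \o h'); split.
- split=> [g a x gG|x] /=; first by rewrite fm // hm.
  by rewrite hs fs.
- split=> [g a x gG|x] /=; first by rewrite h'm // f'm.
  by rewrite f's h's.
- exact: can_comp hK fK.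
- exact: can_comp f'K h'K.
Qed.

Lemma stab_mor X Y (U : fib A G X) (V : fib A G Y) (f : X -> Y) x :
  fib_mor U V f -> injective f -> stab U x = stab V (f x).
Proof.
move=> fm fI; apply/val_inj/setP => g; apply/stabP/stabP => -[gG [a e]];
  split=> //; exists a.
  by rewrite -!fm // e.
by apply: fI; rewrite !fm.
Qed.

Section Sum.
Variables (X Y : Type) (o : gobj X) (o' : gobj Y).
Let U := fib_sum (gfib o) (gfib o').

Lemma stab_inl x : stab (gfib o) x = stab U (inl x).
Proof. by apply: stab_mor => // ? ? []. Qed.
Lemma stab_inr y : stab (gfib o') y = stab U (inr y).
Proof. by apply: stab_mor => // ? ? []. Qed.

Definition sum_sec (z : X + Y) : fobj F (stab U z) :=
  match z with
  | inl x => castF (stab_inl x) (gsec o x)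
  | inr y => castF (stab_inr y) (gsec o' y)
  end.

Lemma sum_sec_proof : is_section sum_sec.
Proof.
move=> g a [] x gG /=; rewrite !atF_cast.
  by rewrite -(gobj_sec o a x gG); apply: atF_conj; exact: atF_cast.
by rewrite -(gobj_sec o' a x gG); apply: atF_conj; exact: atF_cast.
Qed.

Lemma sum_GG z : GG (stab U z).
Proof. by case: z => x; rewrite -(stab_inl, stab_inr); exact: gobj_GG. Qed.

Definition gsum : gobj (X + Y) := GObj sum_GG sum_sec_proof.
End Sum.

Lemma scale_sec_proof X (r : R) (o : gobj X) :
  is_section (fun x => r *: gsec o x).
Proof.
move=> g a x gG /=; rewrite linearZ.
exact: (atF_map (fun=> *:%R r) (gobj_sec o a x gG)).
Qed.
Definition gscale X (r : R) (o : gobj X) : gobj X :=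
  GObj (gobj_GG o) (scale_sec_proof r o).

Lemma add_sec_proof X (U : fib A G X) (s t : forall x, fobj F (stab U x)) :
  is_section s -> is_section t -> is_section (fun x => s x + t x).
Proof.
move=> hs ht g a x gG /=; rewrite linearD.
exact: (atF_add (hs g a x gG) (ht g a x gG)).
Qed.

Lemma gobj_small X (o : gobj X) : exists n (o' : gobj ('I_n * A)), giso o o'.
Proof.
have [n [f [f' [fK f'K]]]] := fib_carrier (gfib o).
pose U := fib_transport (gfib o) fK f'K.
have fm : fib_mor U (gfib o) f by move=> g a y gG /=; rewrite f'K.
have f'm : fib_mor (gfib o) U f' by move=> g a x gG /=; rewrite f'K.
have stE y : stab (gfib o) (f y) = stab U y.
  by apply/esym/stab_mor => //; exact: can_inj fK.
have UG y : GG (stab U y) by rewrite -stE; exact: gobj_GG.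
pose s y := castF (stE y) (gsec o (f y)).
have sP : is_section s.
  move=> g a y gG; rewrite /s !atF_cast -(gobj_sec o a (f y) gG) -fm ?groupV //.
  by apply: atF_conj; exact: atF_cast.
exists n, (GObj UG sP), f', f; split=> //; split=> //= x; rewrite /s atF_cast //.
by rewrite f'K.
Qed.

Definition sgobj := {n & gobj ('I_n * A)}.

Definition gsmall X (o : gobj X) : sgobj :=
  let: exist n h := cid (gobj_small o) in
  Tagged (fun n => gobj ('I_n * A)) (sval (cid h)).

Lemma gsmallP X (o : gobj X) : giso o (tagged (gsmall o)).
Proof. by rewrite /gsmall; case: cid => n h /=; case: cid. Qed.

(* F_+(G) is presented as an abelian group (a Z-module); its R-module structure
   is given by fp_scale. *)
Inductive gam_rel : modterm int sgobj -> modterm int sgobj -> Prop :=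
  | gam_iso o o' : giso (tagged o) (tagged o') -> gam_rel (TGen o) (TGen o')
  | gam_sum o o' o'' : giso (tagged o'') (gsum (tagged o) (tagged o')) ->
      gam_rel (TGen o'') (TAdd (TGen o) (TGen o'))
  | gam_add n (U : fib A G ('I_n * A)) (hU : forall x, GG (stab U x))
      (s t : forall x, fobj F (stab U x)) (hs : is_section s) (ht : is_section t) :
      gam_rel
        (TGen (Tagged (fun n => gobj ('I_n * A)) (GObj hU (add_sec_proof hs ht))))
        (TAdd (TGen (Tagged (fun n => gobj ('I_n * A)) (GObj hU hs)))
              (TGen (Tagged (fun n => gobj ('I_n * A)) (GObj hU ht)))).

Definition Fplus : Type := presmod gam_rel.
HB.instance Definition _ := GRing.Zmodule.on Fplus.

(* [X, s] *)
Definition gcls X (o : gobj X) : Fplus := pmgen gam_rel (gsmall o).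

Definition sgscale (r : R) (o : sgobj) : sgobj :=
  Tagged (fun n => gobj ('I_n * A)) (gscale r (tagged o)).

Definition fp_scale (r : R) (x : Fplus) : Fplus :=
  modeval (fun o => pmgen gam_rel (sgscale r o)) (generic_quotient.repr x).



Lemma gobj_eq X (o o' : gobj X) (e : gfib o = gfib o') :
  (forall x, atF (gsec o x) = atF (gsec o' x)) -> o = o'.
Proof.
case: o o' e => U s hU hs [U' s' hU' hs'] /= e; case: U' / e s' hU' hs'.
move=> s' hU' hs' ss'.
have e : s = s' by apply: functional_extensionality_dep => x; apply: atF_inj.
case: s' / e hs' ss' => hs' _.
by rewrite (Prop_irrelevance hU hU') (Prop_irrelevance hs hs').
Qed.

Lemma gscale_iso X Y (o : gobj X) (o' : gobj Y) r :
  giso o o' -> giso (gscale r o) (gscale r o').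
Proof.
move=> [f [f' [[fm fs] [f'm f's] fK f'K]]]; exists f, f'; split=> //; split=> // x /=.
  exact: (atF_map (fun=> *:%R r) (fs x)).
exact: (atF_map (fun=> *:%R r) (f's x)).
Qed.

Lemma gscale_sum X Y (o : gobj X) (o' : gobj Y) r :
  gscale r (gsum o o') = gsum (gscale r o) (gscale r o').
Proof.
apply: gobj_eq => //= -[] x /=; rewrite atF_cast;
  exact: (atF_map (fun=> *:%R r) (atF_cast _ _)).
Qed.

Lemma giso_sum X Y X' Y' (o : gobj X) (o' : gobj Y) (p : gobj X') (p' : gobj Y') :
  giso o p -> giso o' p' -> giso (gsum o o') (gsum p p').
Proof.
move=> [f [f' [[fm fs] [f'm f's] fK f'K]]] [h [h' [[hm hs] [h'm h's] hK h'K]]].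
exists (fun z => match z with inl x => inl (f x) | inr y => inr (h y) end).
exists (fun z => match z with inl x => inl (f' x) | inr y => inr (h' y) end).
split=> [| |[] x|[] x] /=; rewrite ?fK ?hK ?f'K ?h'K //; split=> [g a [] x gG|[] x] /=;
  by rewrite ?fm ?hm ?f'm ?h'm // !atF_cast // ?fs ?hs ?f's ?h's.
Qed.

Lemma gcls_iso X Y (o : gobj X) (o' : gobj Y) : giso o o' -> gcls o = gcls o'.
Proof.
move=> oo'; apply/presmodP/modeq_rel/gam_iso.
exact: giso_trans (giso_sym (gsmallP o)) (giso_trans oo' (gsmallP o')).
Qed.

Lemma gcls_small (o : sgobj) : gcls (tagged o) = pmgen gam_rel o.
Proof. by apply/presmodP/modeq_rel/gam_iso/giso_sym/gsmallP. Qed.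

Lemma gcls_sum X Y (o : gobj X) (o' : gobj Y) :
  gcls (gsum o o') = gcls o + gcls o'.
Proof.
rewrite -[RHS]/(pm_add _ _) -pi_add; apply/presmodP/modeq_rel/gam_sum.
apply: giso_trans (giso_sym (gsmallP _)) _.
by apply: giso_sum; exact: gsmallP.
Qed.

Lemma fp_scale_pi r (t : modterm int sgobj) :
  fp_scale r (\pi_Fplus t) = modeval (fun o => pmgen gam_rel (sgscale r o)) t.
Proof.
apply: (modeval_eq (gen_rel := gam_rel)); last exact: modeq_repr.
move=> _ _ [o o' oo'|o o' o'' oo'|n U hU s u hs hu] /=.
- by apply/presmodP/modeq_rel/gam_iso/gscale_iso.
- rewrite -[RHS]/(pm_add _ _) -pi_add; apply/presmodP/modeq_rel/gam_sum => /=.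
  by rewrite -gscale_sum; exact: gscale_iso.
- rewrite -[RHS]/(pm_add _ _) -pi_add; apply/presmodP.
  rewrite /sgscale /gscale /=.
  apply: modeq_trans (modeq_rel (gam_add hU (scale_sec_proof r (GObj hU hs))
     (scale_sec_proof r (GObj hU hu)))).
  apply: modeq_rel; apply: gam_iso; exists id, id.
  by split=> //; split=> // x /=; rewrite scalerDr.
Qed.

Lemma modeval_gen (t : modterm int sgobj) :
  modeval (pmgen gam_rel) t = \pi_(presmod gam_rel) t.
Proof.
elim: t => //= [s -> t ->|t ->|z t ->].
- by rewrite pi_add.
- by rewrite pi_opp.
- by rewrite pi_scale.
Qed.

Lemma fp_scale_gen r (o : sgobj) :
  fp_scale r (pmgen gam_rel o) = pmgen gam_rel (sgscale r o).
Proof. exact: fp_scale_pi. Qed.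

Lemma fp_scaleD r : {morph fp_scale r : x y / x + y}.
Proof.
elim/quotW=> s; elim/quotW=> t.
by rewrite -[_ + _ in LHS]/(pm_add _ _) -pi_add !fp_scale_pi.
Qed.

Lemma fp_scale_eval r (f : sgobj -> presmod gam_rel) (t : modterm int sgobj) :
  fp_scale r (modeval f t) = modeval (fun o => fp_scale r (f o)) t.
Proof.
have s0 : fp_scale r 0 = 0 by apply: (addrI (fp_scale r 0)); rewrite -fp_scaleD !addr0.
have sN x : fp_scale r (- x) = - fp_scale r x.
  by apply: (addrI (fp_scale r x)); rewrite -fp_scaleD !subrr.
elim: t => //= [s <- t <-|t <-|z t <-]; rewrite ?fp_scaleD ?sN //.
elim/quotW: (modeval f t) => u.
by rewrite -[_ *: _ in LHS]/(pm_scale _ _) -pi_scale !fp_scale_pi.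
Qed.

Lemma fp_scaleA q r x : fp_scale q (fp_scale r x) = fp_scale (q * r) x.
Proof.
elim/quotW: x => t; rewrite !fp_scale_pi fp_scale_eval.
congr (modeval _ t); apply: funext => o; rewrite fp_scale_gen; congr (pmgen _ _).
case: o => n o; congr existT; apply: gobj_eq => //= x.
by rewrite scalerA.
Qed.

Lemma fp_scale1 : left_id 1 fp_scale.
Proof.
elim/quotW=> t; rewrite fp_scale_pi -[RHS]modeval_gen.
congr (modeval _ t); apply: funext => o; congr (pmgen _ _).
case: o => n o; congr existT; apply: gobj_eq => //= x.
by rewrite scale1r.
Qed.

Lemma fp_scaleDl x : {morph fp_scale^~ x : q r / q + r}.
Proof.
move=> q r; elim/quotW: x => t; rewrite !fp_scale_pi.
rewrite -[RHS](modevalD (M := presmod gam_rel)); congr (modeval _ t).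
apply: funext => -[n o].
rewrite -[RHS]/(pm_add _ _) -pi_add; apply/presmodP; rewrite /sgscale /gscale /=.
apply: modeq_trans (modeq_rel (gam_add (gobj_GG o) (scale_sec_proof q o)
  (scale_sec_proof r o))).
apply: modeq_rel; apply: gam_iso; exists id, id.
by split=> //; split=> // x /=; rewrite scalerDl.
Qed.

HB.instance Definition _ := GRing.Zmodule_isLmodule.Build R Fplus
  fp_scaleA fp_scale1 fp_scaleD fp_scaleDl.

Lemma gcls_scale X r (o : gobj X) : r *: gcls o = gcls (gscale r o).
Proof.
rewrite -[LHS]/(fp_scale r _) fp_scale_gen -gcls_small.
exact/gcls_iso/gscale_iso/giso_sym/gsmallP.
Qed.

Record mprime := MPrime {
  mpval : mpair A gT;
  _ : (mgrp mpval \subset G) && `[< GG (mgrp mpval) >] }.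
HB.instance Definition _ := [isSub for mpval].
HB.instance Definition _ := [Choice of mprime by <:].

Definition mpgrp (P : mprime) : {group gT} := mgrp (val P).

Definition mprime_le (P Q : mprime) : bool := mple (val P) (val Q).

Fixpoint moebius_rec (n : nat) (P Q : mprime) : int :=
  if P == Q then 1
  else if n is n'.+1 then
    if mprime_le P Q then
      - \sum_(T \in [set T | [&& mprime_le P T, mprime_le T Q & T != Q]])
          moebius_rec n' P T
    else 0
  else 0.

(* #|Q| rounds suffice; see moebiusE. *)
Definition moebius (P Q : mprime) : int := moebius_rec #|mpgrp Q| P Q.

Lemma mple_refl (P : mpair A gT) : mple P P.
Proof. by rewrite /mple subxx; apply/forall_inP. Qed.

Lemma mprime_lt_card P Q : mprime_le P Q -> P != Q ->
  (#|mpgrp P| < #|mpgrp Q|)%N.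
Proof.
move=> /andP[sPQ /forall_inP ePQ] nPQ; apply: proper_card.
rewrite finset.properEneq sPQ andbT; apply: contra_neq nPQ => e.
apply/val_inj/mpair_eq; first exact: val_inj.
move=> x; have [xP|xP] := boolP (x \in mgrp (val P)); first exact/eqP/ePQ.
by rewrite !mchar_out //; move: xP; rewrite e.
Qed.

Lemma moebius_rec_fuel n n' P Q : (#|mpgrp Q| <= n)%N -> (#|mpgrp Q| <= n')%N ->
  moebius_rec n P Q = moebius_rec n' P Q.
Proof.
elim: n n' Q => [|n IHn] [|n'] Q; rewrite ?leqn0 -?lt0n ?(gtn_eqF (cardG_gt0 _)) //.
move=> Qn Qn' /=; case: ifP => // _; case: ifP => // _; congr (- _).
apply: eq_fsbigr => T; rewrite inE /= => /and3P[_ TQ nTQ].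
by have lt := mprime_lt_card TQ nTQ; apply: IHn; rewrite -ltnS;
  apply: leq_trans lt _.
Qed.

Lemma moebiusE P Q : moebius P Q =
  if P == Q then 1
  else if mprime_le P Q then
    - \sum_(T \in [set T | [&& mprime_le P T, mprime_le T Q & T != Q]]) moebius P T
  else 0.
Proof.
rewrite /moebius; have := cardG_gt0 (mpgrp Q).
case e : #|mpgrp Q| => [//|n] _ /=.
case: ifP => // _; case: ifP => // _; congr (- _).
apply: eq_fsbigr => T; rewrite inE /= => /and3P[_ TQ nTQ].
by apply: moebius_rec_fuel => //; rewrite -ltnS -e; exact: mprime_lt_card.
Qed.

Record Fupper := MkFupper {
  fufun : forall P : mprime, fobj F (mpgrp P);
  fu_fin : finite_set [set P | fufun P != 0];
  fu_inv : forall g P Q, g \in G -> val Q = mconj g (val P) ->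
    atF (conjF g _ (fufun P)) = atF (fufun Q) }.

HB.instance Definition _ := gen_eqMixin Fupper.
HB.instance Definition _ := gen_choiceMixin Fupper.

Lemma fu_eq (x y : Fupper) : (forall P, fufun x P = fufun y P) -> x = y.
Proof.
case: x y => x fx ix [y fy iy] /= e.
have exy : x = y by apply: functional_extensionality_dep.
case: y / exy fy iy {e} => fy iy.
by rewrite (Prop_irrelevance fx fy) (Prop_irrelevance ix iy).
Qed.

Lemma fu_zero_fin : finite_set [set P : mprime | (0 : fobj F (mpgrp P)) != 0].
Proof. by apply: (@sub_finite_set _ _ set0) => // P /=; rewrite eqxx. Qed.
Lemma fu_zero_inv g P Q : g \in G -> val Q = mconj g (val P) ->
  atF (conjF g _ (0 : fobj F (mpgrp P))) = atF (0 : fobj F (mpgrp Q)).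
Proof.
move=> _ e; rewrite linear0 /mpgrp e.
by have -> : mgrp (mconj g (val P)) = lconjg g (mgrp (val P)) by [].
Qed.
Definition fu_zero := MkFupper fu_zero_fin fu_zero_inv.

Lemma fu_add_fin (x y : Fupper) :
  finite_set [set P | fufun x P + fufun y P != 0].
Proof.
apply: (@sub_finite_set _ _ ([set P | fufun x P != 0] `|` [set P | fufun y P != 0])).
  move=> P /=; have [->|xP] := eqVneq (fufun x P) 0; last by left.
  by rewrite add0r; right.
by rewrite finite_setU; split; exact: fu_fin.
Qed.
Lemma fu_add_inv (x y : Fupper) g P Q : g \in G -> val Q = mconj g (val P) ->
  atF (conjF g _ (fufun x P + fufun y P)) = atF (fufun x Q + fufun y Q).
Proof. by move=> gG e; rewrite linearD; apply: atF_add; exact: fu_inv. Qed.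
Definition fu_add x y := MkFupper (@fu_add_fin x y) (@fu_add_inv x y).

Lemma fu_scale_fin r (x : Fupper) : finite_set [set P | r *: fufun x P != 0].
Proof.
apply: sub_finite_set (fu_fin x) => P /=; apply: contra_neq => ->.
exact: scaler0.
Qed.
Lemma fu_scale_inv r (x : Fupper) g P Q : g \in G -> val Q = mconj g (val P) ->
  atF (conjF g _ (r *: fufun x P)) = atF (r *: fufun x Q).
Proof.
by move=> gG e; rewrite linearZ; exact: (atF_map (fun=> *:%R r) (fu_inv _ gG e)).
Qed.
Definition fu_scale r x := MkFupper (@fu_scale_fin r x) (@fu_scale_inv r x).

Lemma fu_addA : associative fu_add.
Proof. by move=> x y z; apply: fu_eq => P /=; rewrite addrA. Qed.
Lemma fu_addC : commutative fu_add.
Proof. by move=> x y; apply: fu_eq => P /=; rewrite addrC. Qed.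
Lemma fu_add0 : left_id fu_zero fu_add.
Proof. by move=> x; apply: fu_eq => P /=; rewrite add0r. Qed.
Lemma fu_addN : left_inverse fu_zero (fu_scale (-1)) fu_add.
Proof. by move=> x; apply: fu_eq => P /=; rewrite scaleN1r addNr. Qed.
HB.instance Definition _ :=
  GRing.isZmodule.Build Fupper fu_addA fu_addC fu_add0 fu_addN.

Lemma fu_scaleA q r x : fu_scale q (fu_scale r x) = fu_scale (q * r) x.
Proof. by apply: fu_eq => P /=; rewrite scalerA. Qed.
Lemma fu_scale1 : left_id 1 fu_scale.
Proof. by move=> x; apply: fu_eq => P /=; rewrite scale1r. Qed.
Lemma fu_scaleDr : right_distributive fu_scale +%R.
Proof. by move=> r x y; apply: fu_eq => P /=; rewrite scalerDr. Qed.
Lemma fu_scaleDl x : {morph fu_scale^~ x : q r / q + r}.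
Proof. by move=> q r; apply: fu_eq => P /=; rewrite scalerDl. Qed.
HB.instance Definition _ := GRing.Zmodule_isLmodule.Build R Fupper
  fu_scaleA fu_scale1 fu_scaleDr fu_scaleDl.

Definition orbit_reps X (U : fib A G X) n (r : 'I_n -> X) : Prop :=
  forall x, exists! i, exists a, x = fact U 1%g a (r i).

(* m [X, s] is the family of marks, for every choice of representatives r of
   the A-orbits of X. *)
Definition is_mark (m : Fplus -> Fupper) : Prop :=
  forall X (o : gobj X) n (r : 'I_n -> X), orbit_reps (gfib o) r ->
  forall P : mprime, fufun (m (gcls o)) P =
    \sum_(i < n | mple (val P) (stab_pair (gfib o) (r i)))
      resF (mpgrp P) (stab (gfib o) (r i)) (gsec o (r i)).

Definition is_std (P : mpair A gT) (b : fobj F (mgrp P)) (o : gobj (orbcar G P)) :=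
  gfib o = orbset G P /\ atF (gsec o (orb_base G P)) = atF b.

(* [L, psi, b] for P = (L, psi). An equivariant section is determined by its
   value b at the base point; 0 is only used if there is no such section. *)
Definition std_cls (P : mpair A gT) (b : fobj F (mgrp P)) : Fplus :=
  if pselect (exists o, is_std b o) is left h then gcls (sval (cid h)) else 0.

Definition nmap (x : Fupper) : Fplus :=
  \sum_(p \in [set p : mprime * mprime | mprime_le p.1 p.2])
    std_cls (resF (mpgrp p.1) (mpgrp p.2) (fufun x p.2))
      *~ (#|mpgrp p.1|%:Z * moebius p.1 p.2).

End OneGroup.
End Data.

(* Main.v *)
From HB Require Import structures.
Require Import Defs.
From mathcomp Require Import all_boot all_algebra all_fingroup.
From mathcomp Require Import boolp classical_sets functions cardinality fsbigop.

(* Every restriction and conjugation is F applied to a twisted diagonal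
   {(x, g^-1 x g) : x in L} in L x K; these compose by multiplying the twisting
   elements, and inner twists act trivially. Cutting an A-fibered G-set into
   orbits shows that F_+(G) is spanned by the classes [P, b], for P in M'(G), and
   counting the g in G instead of the cosets of P gives the integral formula
     |P| m([P, b])_T = sum over g in G with T <= gP of F(Res)(gb).
   With mu the Moebius function this yields
     |P| n(m([P, b])) = sum_g sum_T |T| (sum_(T <= Q <= gP) mu(T, Q)) [T, Res gb],
     m(n(a))_T = sum_g sum_Q (sum_(g^-1 T <= P <= Q) mu(P, Q)) F(c_g) a_Q,
   where c_g conjugates Q down to T. By the two forms of Moebius inversion only
   T = gP survives in the first sum and Q = g^-1 T in the second, so both
   composites are multiplication by |G| (|P| can be cancelled, as it divides
   |G|). M'(G) may be infinite because A may be, so all sums run over finite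
   down-closed sets of pairs that contain the support. *)

Set Implicit Arguments.
Unset Strict Implicit.
Unset Printing Implicit Defensive.

Import GRing.Theory.
Local Open Scope classical_set_scope.
Local Open Scope ring_scope.

(** * Transitive fibered sets *)

Section FiberedSets.
Variables (A : zmodType) (gT : finGroupType) (G : {group gT}).

(** Freeness of the [A]-action makes the scalar unique, so one equation records both the stabilizer
    and its character. *)
Lemma stab_pairP X (U : fib A G X) x g a : g \in G ->
  fact U g 0 x = fact U 1%g a x <->
  g \in mgrp (stab_pair U x) /\ mchar (stab_pair U x) g = a.
Proof.
move=> gG; rewrite mgrp_mkpair; split=> [e|[gS <-]].
  have gS : g \in stab U x by apply/stabP; split=> //; exists a.
  split=> //; rewrite mchar_mkpair //.
  by apply: (@factA_inj _ _ _ _ U x); rewrite /= -e -stab_charE.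
by rewrite mchar_mkpair // -stab_charE.
Qed.

(** The converse criterion: a stabilizer pair is computed by solving [g x = a x]. *)
Lemma stab_pair_uniq X (U : fib A G X) x (P : mpair A gT) :
  mgrp P \subset G ->
  (forall g a, g \in G -> fact U g 0 x = fact U 1%g a x <->
     g \in mgrp P /\ mchar P g = a) ->
  stab_pair U x = P.
Proof.
move=> sPG PP.
have sUG : stab U x \subset G by apply/fintype.subsetP => g /stabP[].
have eG : mgrp (stab_pair U x) = mgrp P.
  apply/val_inj/setP => g; apply/idP/idP => gS.
    have gG := fintype.subsetP sUG g gS.
    have /(PP _ _ gG)[] // := (stab_pairP U x (mchar (stab_pair U x) g) gG).2
       (conj gS erefl).
  have gG := fintype.subsetP sPG g gS.
  by have /(stab_pairP U x _ gG)[] := (PP _ _ gG).2 (conj gS erefl).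
apply: mpair_eq => // g; have [gS|gS] := boolP (g \in mgrp P).
  have gG := fintype.subsetP sPG g gS.
  by have /(stab_pairP U x _ gG)[] := (PP _ _ gG).2 (conj gS erefl).
by rewrite !mchar_out // eG.
Qed.

Lemma stab_sub X (U : fib A G X) x : stab U x \subset G.
Proof. by apply/fintype.subsetP => g /stabP[]. Qed.

Lemma stab_pair_mor X Y (U : fib A G X) (V : fib A G Y) (f : X -> Y) x :
  fib_mor U V f -> injective f -> stab_pair V (f x) = stab_pair U x.
Proof.
move=> fm fI; apply: stab_pair_uniq; first exact: stab_sub.
move=> g a gG; rewrite -!fm //; split=> [/fI|].
  by move/(stab_pairP U x _ gG).
by move/(stab_pairP U x _ gG) => ->.
Qed.

(** * Conjugation of subgroups and pairs *)

Lemma mem_lconjg (g x : gT) (K : {group gT}) : (x \in lconjg g K) = (x ^ g \in K)%g.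
Proof. by rewrite mem_conjgV. Qed.

Lemma lconjgM (g h : gT) (K : {group gT}) : lconjg (g * h)%g K = lconjg g (lconjg h K).
Proof. by apply/val_inj/setP => x; rewrite !mem_lconjg conjgM. Qed.

Lemma lconjg1 (K : {group gT}) : lconjg 1%g K = K.
Proof. by apply/val_inj/setP => x; rewrite mem_lconjg conjg1. Qed.

Lemma lconjg_sub (g : gT) (K : {group gT}) : g \in G -> K \subset G ->
  lconjg g K \subset G.
Proof.
move=> gG sKG; apply/fintype.subsetP => x; rewrite mem_lconjg => /(fintype.subsetP sKG).
by rewrite groupJr.
Qed.

Lemma lconjg_in (g : gT) (K : {group gT}) : g \in K -> lconjg g K = K.
Proof. by move=> gK; apply/val_inj/setP => x; rewrite mem_lconjg groupJr. Qed.

Lemma mchar_conj g (P : mpair A gT) x : mchar (mconj g P) x = mchar P (x ^ g)%g.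
Proof.
have [xP|xP] := boolP (x \in lconjg g (mgrp P)); first by rewrite mchar_mkpair.
by rewrite !mchar_out //; move: xP; rewrite mem_lconjg.
Qed.

Lemma mconjM g h (P : mpair A gT) : mconj (g * h)%g P = mconj g (mconj h P).
Proof.
apply: mpair_eq; first exact: lconjgM.
by move=> x; rewrite !mchar_conj conjgM.
Qed.

Lemma mconj1 (P : mpair A gT) : mconj 1%g P = P.
Proof. by apply: mpair_eq => [|x]; [exact: lconjg1|rewrite mchar_conj conjg1]. Qed.

(** Acting by [h] after [g] is acting by [g] after [h ^ g], so [h] scales [g x] exactly as [h ^ g]
    scales [x]. *)
Lemma stab_pair_act X (U : fib A G X) g a x : g \in G ->
  stab_pair U (fact U g a x) = mconj g (stab_pair U x).
Proof.
move=> gG; apply: stab_pair_uniq => [|h b hG].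
  by apply: lconjg_sub => //; exact: stab_sub.
have hgG : (h ^ g)%g \in G by rewrite groupJ.
rewrite mem_lconjg mchar_conj; apply: iff_trans (stab_pairP U x b hgG).
have -> : fact U h 0 (fact U g a x) = fact U g a (fact U (h ^ g)%g 0 x).
  by rewrite -!factM // conjgE mulKVg add0r addr0.
have -> : fact U 1%g b (fact U g a x) = fact U g a (fact U 1%g b x).
  by rewrite -!factM ?group1 // mul1g mulg1 addrC.
by split=> [e|->//]; rewrite -[LHS](factVK U a _ gG) e factVK.
Qed.

Lemma pcoset_eq (P : mpair A gT) g a h b : pcoset P g a = pcoset P h b ->
  exists2 l, l \in mgrp P & h = (g * l)%g /\ b = a - mchar P l.
Proof.
move=> e; have := pcoset_refl P h b; rewrite -e => -[l lP [-> ->]].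
by exists l.
Qed.

Lemma pcosetM (P : mpair A gT) g a l : l \in mgrp P ->
  pcoset P (g * l) (a - mchar P l) = pcoset P g a.
Proof.
move=> lP; apply/seteqP; split=> [_ [k kP ->]|_ [k kP ->]].
  by exists (l * k)%g; rewrite ?groupM // mcharM // mulgA opprD addrA.
exists (l^-1 * k)%g; first by rewrite groupM ?groupV.
rewrite mulgA mulgK; congr pair.
have := mcharM lP (groupM (groupVr lP) kP); rewrite mulKVg => ->.
by rewrite opprD addrA.
Qed.

(** * Maps out of a transitive fibered set *)

Section OrbitMap.
Variables (X : Type) (U : fib A G X) (x : X).
Let P := stab_pair U x.

Lemma stab_factE g a l : g \in G -> l \in mgrp P ->
  fact U (g * l)%g (a - mchar P l) x = fact U g a x.
Proof.
move=> gG lP; have lG := fintype.subsetP (stab_sub U x) l lP.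
rewrite factM //; congr fact.
rewrite Defs.fact_split // ((stab_pairP U x _ lG).2 (conj lP erefl)) -factM ?group1 //.
by rewrite mulg1 addNr fact1.
Qed.

(** The orbit-stabilizer principle for [G x A]: points of the orbit of [x] correspond to cosets. *)
Lemma fact_orbit_eq g a h b : g \in G -> h \in G ->
  fact U g a x = fact U h b x <-> pcoset P g a = pcoset P h b.
Proof.
move=> gG hG; split=> [e|/pcoset_eq[l lP [-> ->]]]; last by rewrite stab_factE.
have lG : (g^-1 * h)%g \in G by rewrite groupM ?groupV.
have /(stab_pairP U x _ lG)[lP el] : fact U (g^-1 * h)%g 0 x = fact U 1%g (a - b) x.
  (* The element [(g^-1 h, - a + b)] fixes [x]; splitting the scalar 0 exposes it. *)
  have -> : 0 = (a - b) + (- a + b) by rewrite [- a + b]addrC -(opprB a b) subrr.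
  rewrite -[(g^-1 * h)%g]mul1g factM ?groupM ?groupV //; congr fact.
  by rewrite factM ?groupV // -e factVK ?groupV.
have -> : h = (g * (g^-1 * h))%g by rewrite mulKVg.
have -> : b = a - mchar P (g^-1 * h)%g by rewrite el opprB addrCA subrr addr0.
by rewrite pcosetM.
Qed.

Let pick (C : orbcar G P) : {p : gT * A | p.1 \in G /\ sval C = pcoset P p.1 p.2}.
Proof.
apply: cid; have [g [a [gG e]]] := svalP C.
by exists (g, a).
Qed.

(** A representative of the coset is chosen; [orbit_mapE] shows that the choice does not matter. *)
Definition orbit_map (C : orbcar G P) : X :=
  let p := sval (pick C) in fact U p.1 p.2 x.

Lemma orbit_mapE C g a : g \in G -> sval C = pcoset P g a ->
  orbit_map C = fact U g a x.
Proof.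
move=> gG e; rewrite /orbit_map; have [hG e'] := svalP (pick C).
by apply/fact_orbit_eq => //; rewrite -e -e'.
Qed.

Lemma orbit_map_mor : fib_mor (orbset G P) U orbit_map.
Proof.
move=> g a C gG; have [h [b [hG e]]] := svalP C.
rewrite (@orbit_mapE _ (g * h)%g (a + b)) ?groupM //; last first.
  by rewrite /= orb_actE // e ltransE.
by rewrite factM // (orbit_mapE hG e).
Qed.

Lemma orbit_map_inj : injective orbit_map.
Proof.
move=> C C'; have [g [a [gG e]]] := svalP C; have [h [b [hG e']]] := svalP C'.
rewrite (orbit_mapE gG e) (orbit_mapE hG e') => /fact_orbit_eq eP.
by apply: sval_inj; rewrite e e'; exact: eP.
Qed.

Lemma orbit_map_base : orbit_map (orb_base G P) = x.
Proof. by rewrite (@orbit_mapE _ 1%g 0) ?fact1. Qed.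

(** A transitive fibered set is classified by the stabilizer pair of any one of its points. *)
Lemma fib_iso_orbset : (forall y, exists g a, g \in G /\ y = fact U g a x) ->
  fib_iso (orbset G P) U.
Proof.
move=> tr; apply: fib_iso_bij orbit_map_mor orbit_map_inj _ => y.
have [g [a [gG ->]]] := tr y.
exists (fact (orbset G P) g a (orb_base G P)).
by rewrite orbit_map_mor // orbit_map_base.
Qed.

End OrbitMap.

Lemma orb_baseE (P : mpair A gT) (C : orbcar G P) : exists g a, g \in G /\
  C = fact (orbset G P) g a (orb_base G P).
Proof.
have [g [a [gG e]]] := svalP C; exists g, a; split=> //; apply: sval_inj.
by rewrite /= orb_actE //= ltransE mulg1 addr0.
Qed.

(** The two pairs are the stabilizer pairs of two points of one transitive set. *)
Lemma orbset_conj_iso (P : mpair A gT) g : mgrp P \subset G -> g \in G ->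
  fib_iso (orbset G (mconj g P)) (orbset G P).
Proof.
move=> sPG gG; have -> : mconj g P =
    stab_pair (orbset G P) (fact (orbset G P) g 0 (orb_base G P)).
  by rewrite stab_pair_act // stab_base.
apply: fib_iso_orbset => C; have [h [a [hG ->]]] := orb_baseE C.
exists (h * g^-1)%g, a; rewrite groupM ?groupV //; split=> //.
by rewrite -factM ?groupM ?groupV // mulgKV addr0.
Qed.

End FiberedSets.

(** * Twisted diagonals *)

Section TwistedDiagonals.
Variables (A : zmodType) (gT : finGroupType).
Implicit Types (L K M : {group gT}) (g h k : gT).

(* {(x, g^-1 x g) : x in L}; restrictions are the case g = 1, and conjugations
   F(L) -> F(gLg^-1) come from the group lconjg g L. *)
Definition twdiag L g : {group gT * gT} := twistg g (L :^ g)%G.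

Lemma mem_twdiag L g x y : ((x, y) \in twdiag L g) = (x \in L) && (y == x ^ g)%g.
Proof.
apply/imsetP/andP => [[z zL [-> ->]]|[xL /eqP ->]].
  by rewrite -conjgM mulVg conjg1 eqxx -mem_conjg.
by exists (x ^ g)%g; rewrite ?conjgK // memJ_conjg.
Qed.

Lemma twdiag1 L : twdiag L 1 = diagg L.
Proof.
apply/val_inj/setP => -[x y]; rewrite mem_twdiag conjg1.
by apply/andP/imsetP => [[xL /eqP ->]|[z zL [-> ->]]]; [exists x|rewrite eqxx].
Qed.

Lemma twdiag_conj L g : twdiag (lconjg g L) g = twistg g L.
Proof.
apply/val_inj/setP => -[x y]; rewrite mem_twdiag mem_lconjg.
apply/andP/imsetP => [[xL /eqP ->]|[z zL [-> ->]]].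
  by exists (x ^ g)%g; rewrite // conjgK.
by rewrite -conjgM mulVg conjg1 eqxx.
Qed.

Lemma mchar_mtriv (hT : finGroupType) (D : {group hT}) x : mchar (mtriv A D) x = 0.
Proof.
have [xD|xD] := boolP (x \in D); first by rewrite mchar_mkpair.
by rewrite mchar_out.
Qed.

Definition twpair L g : mpair A (gT * gT)%type := mtriv A (twdiag L g).

Lemma twdiag_sub L g K : (L :^ g)%g \subset K -> twdiag L g \subset prodg L K.
Proof.
move=> sLK; apply/fintype.subsetP => -[x y]; rewrite mem_twdiag => /andP[xL /eqP ->].
by rewrite inE /= xL (fintype.subsetP sLK) // memJ_conjg.
Qed.

(** Conjugation in the second coordinate changes only the twist. This gives all twists from
    restrictions, and it is why inner twists act trivially. *)
Lemma mconj_twpair L g k : mconj (1, k)%g (twpair L g) = twpair L (g * k^-1)%g.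
Proof.
apply: mpair_eq => [|x]; last by rewrite mchar_conj !mchar_mtriv.
apply/val_inj/setP => -[x y]; rewrite mem_lconjg.
rewrite -[((x, y) ^ _)%g]/(x ^ 1, y ^ k)%g !mem_twdiag conjg1; congr andb.
by rewrite conjgM -[RHS](inj_eq (conjg_inj k)) -conjgM mulVg conjg1.
Qed.

Lemma fact_base_eq (hT : finGroupType) (H D : {group hT}) p q (a b : A) :
  D \subset H -> p \in H -> q \in H ->
  fact (orbset H (mtriv A D)) p a (orb_base H (mtriv A D)) =
  fact (orbset H (mtriv A D)) q b (orb_base H (mtriv A D)) <->
  (p^-1 * q)%g \in D /\ a = b.
Proof.
move=> sDH pH qH; apply: iff_trans (fact_orbit_eq _ _ _ _ pH qH) _.
rewrite stab_base //; split=> [/pcoset_eq[l lD [-> ->]]|[lD ->]].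
  by rewrite mulKg mchar_mtriv subr0.
by rewrite -(@pcosetM _ _ (mtriv A D) p b _ lD) mchar_mtriv subr0 mulKVg.
Qed.

(** Both pairs lie in one [(H x A)]-orbit. The lemma serves to slide group elements and scalars
    across the tensor sign. *)
Lemma tens_orbit (G H K : {group gT}) X Y (U : fib A (prodg G H) X)
    (V : fib A (prodg H K) Y) u v k c : k \in H ->
  tens U V (fact U (1, k)%g (- c) u) (fact V (k, 1)%g c v) = tens U V u v.
Proof.
move=> kH; have iU x : x \in H -> (1%g, x) \in prodg G H by rewrite inE /= group1.
have iV x : x \in H -> (x, 1%g) \in prodg H K by rewrite inE /= group1 andbT.
apply/seteqP; split=> [_ [y [a [yH ->]]]|_ [y [a [yH ->]]]].
  exists (y * k)%g, (a + c); split; first exact: groupM.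
  rewrite -factM ?iU // -factM ?iV // opprD.
  by rewrite -[((1, y) * _)%g]/(1 * 1, y * k)%g -[((y, 1) * _)%g]/(y * k, 1 * 1)%g !mulg1.
exists (y * k^-1)%g, (a - c); split; first by rewrite groupM ?groupV.
have yk : (y * k^-1)%g \in H by rewrite groupM ?groupV.
rewrite -factM ?iU // -factM ?iV // -opprD subrK.
rewrite -[((1, _) * _)%g]/(1 * 1, y * k^-1 * k)%g -[((_, 1) * _)%g]/(y * k^-1 * k, 1 * 1)%g.
by rewrite mulgKV !mulg1.
Qed.

(** * Tensor products of twisted diagonals *)

Section Tensor.
Variables (L K M : {group gT}) (g h : gT).
Hypotheses (sLK : (L :^ g)%g \subset K) (sKM : (K :^ h)%g \subset M).
Let U := orbset (prodg L K) (twpair L g).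
Let V := orbset (prodg K M) (twpair K h).
Let u := orb_base (prodg L K) (twpair L g).
Let v := orb_base (prodg K M) (twpair K h).

Let inp (L' K' : {group gT}) x y : x \in L' -> y \in K' -> (x, y) \in prodg L' K'.
Proof. by move=> xL yK; rewrite inE /= xL. Qed.
Let oneE : 1%g = (1, 1)%g :> gT * gT. Proof. by []. Qed.

Let mulE (x y x' y' : gT) : ((x, y) * (x', y') = (x * x', y * y'))%g. Proof. by []. Qed.
Let invE (x y : gT) : ((x, y)^-1 = (x^-1, y^-1))%g. Proof. by []. Qed.

(** Since both characters are trivial, an element [(k, c)] of [K x A] carrying the first
    representative to the second must have [c = 0] and [k = (x'^-1 x)^g]. Applying the twist [h] to
    [k] relates [y] and [y']. *)
Let tens_eq x y a x' y' a' :
  x \in L -> x' \in L -> y \in M -> y' \in M ->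
  tens U V (fact U (x, 1)%g a u) (fact V (1, y)%g 0 v) =
  tens U V (fact U (x', 1)%g a' u) (fact V (1, y')%g 0 v) <->
  (x^-1 * x', y^-1 * y')%g \in twdiag L (g * h) /\ a = a'.
Proof.
move=> xL x'L yM y'M; split=> [e|[]].
  have : tens U V (fact U (x', 1)%g a' u) (fact V (1, y')%g 0 v)
      (fact U (x', 1)%g a' u, fact V (1, y')%g 0 v).
    by exists 1%g, 0; split=> //; rewrite oppr0 !fact1.
  rewrite -e => -[k [c [kK /pair_equal_spec[]]]].
  rewrite -!factM ?inp // !mulE !mul1g !mulg1 addr0 => eU eV.
  have := (fact_base_eq _ _ (twdiag_sub sLK) (inp x'L (group1 K)) (inp xL kK)).1 eU.
  have := (fact_base_eq _ _ (twdiag_sub sKM) (inp (group1 K) y'M) (inp kK yM)).1 eV.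
  rewrite !invE !mulE !invg1 !mul1g !mem_twdiag => -[/andP[_ /eqP ey] <-].
  rewrite oppr0 add0r => -[/andP[xx /eqP ek] ->]; split=> //.
  rewrite -groupV invMg invgK xx /=; apply/eqP.
  by rewrite -[(y^-1 * y')%g]invgK invMg invgK ey ek -conjgM -conjVg invMg invgK.
rewrite mem_twdiag => /andP[xx /eqP ey] <-.
have kK : ((x^-1 * x') ^ g)%g \in K by rewrite (fintype.subsetP sLK) // memJ_conjg.
rewrite -(tens_orbit _ _ _ _ 0 (k := (((x^-1 * x') ^ g)^-1)%g)) ?groupV //.
rewrite oppr0 -!factM ?inp ?groupV // !mulE !mul1g !mulg1 !add0r; congr tens.
  apply/fact_base_eq; rewrite ?twdiag_sub ?inp ?groupV //; split=> //.
  by rewrite invE mulE mem_twdiag xx invgK mulg1 eqxx.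
apply/fact_base_eq; rewrite ?twdiag_sub ?inp ?groupV //; split=> //.
by rewrite invE mulE mem_twdiag invgK mulg1 kK ey conjgM eqxx.
Qed.

(** By [tens_eq] the class of [(u, v)] has the composite twisted diagonal as stabilizer pair. Its
    orbit is everything: the first projection of [twdiag K h] is all of [K], so a single double
    coset occurs. *)
Lemma tensor_twpair : fib_iso (orbset (prodg L M) (twpair L (g * h)%g)) (tensor U V).
Proof.
have sLM : (L :^ (g * h) \subset M)%g.
  by rewrite conjsgM; apply: fintype.subset_trans sKM; rewrite conjSg.
have tE x y a : x \in L -> y \in M -> tens_move U V (x, y) a (tens U V u v) =
    tens U V (fact U (x, 1)%g a u) (fact V (1, y)%g 0 v).
  by move=> xL yM; rewrite tens_moveE.
have uvP : is_tens U V (tens U V u v).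
  split=> [|c]; first by exists u, v.
  rewrite -[RHS](tens_move1 U V) oneE !tE //.
  by move=> /tens_eq[].
pose O : tenscar U V := exist _ _ uvP.
have tO x y a : x \in L -> y \in M -> sval (fact (tensor U V) (x, y) a O) =
    tens U V (fact U (x, 1)%g a u) (fact V (1, y)%g 0 v).
  by move=> xL yM; rewrite /= tens_actE ?inp //= tE.
have <- : stab_pair (tensor U V) O = twpair L (g * h)%g.
  apply: stab_pair_uniq; first exact: twdiag_sub.
  move=> [x y] a; rewrite inE /= => /andP[xL yM].
  rewrite mchar_mtriv; split=> [/(congr1 sval)|[xy <-]].
    rewrite oneE !tO // => /tens_eq[] //; rewrite !mulg1 => xy ->.
    by split=> //; have := groupVr xy; rewrite invE !invgK.
  apply: sval_inj; rewrite oneE !tO //; apply/tens_eq => //; split=> //.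
  by rewrite !mulg1 -[(_, _)]/((x, y)^-1)%g groupV.
apply: fib_iso_orbset => O'; have [[u' [v' e]] _] := svalP O'.
have [[l k] [a [/= + eu]]] := orb_baseE u'; rewrite inE /= => /andP[lL kK].
have [[k' m] [b [/= + ev]]] := orb_baseE v'; rewrite inE /= => /andP[k'K mM].
have kk : (k^-1 * k')%g \in K by rewrite groupM ?groupV.
have km : ((k^-1 * k') ^ h)%g \in M by rewrite (fintype.subsetP sKM) // memJ_conjg.
(* Sliding [k] to the right leaves [k^-1 k'] on [v], which the twist [h] trades for an element of
   [M]; the scalars [a] and [b] add up. *)
exists (l, m * ((k^-1 * k') ^ h)^-1)%g, (a + b).
have mM' : (m * ((k^-1 * k') ^ h)^-1)%g \in M by rewrite groupM ?groupV.
split; first exact: inp.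
apply: sval_inj; rewrite tO // e eu ev.
rewrite -(tens_orbit _ _ _ _ (- b) (k := k^-1%g)) ?groupV //.
rewrite -!factM ?inp ?groupV // !mulE !mul1g mulVg opprK addNr [b + a]addrC.
congr tens; apply/fact_base_eq; rewrite ?twdiag_sub ?inp //; split=> //.
by rewrite invE mulE mem_twdiag mulg1 mulKg groupV kk conjVg eqxx.
Qed.

End Tensor.
End TwistedDiagonals.

(** * Restriction and conjugation *)

Section Functor.
Variables (A : zmodType) (R : comPzRingType) (GG : grpclass) (S : pairfamily A).
Hypotheses (Sii : axiom_ii GG S) (Siv : axiom_iv GG S)
  (Svi : axiom_vi GG S) (Svii : axiom_vii GG S).
Variables (F : functorD GG S R) (gT : finGroupType) (G : {group gT}) (GG_G : GG G).
Implicit Types (L K M : {group gT}) (g h k : gT).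

Lemma mdiagE L : mdiag A L = twpair A L 1.
Proof. by rewrite /mdiag /twpair twdiag1. Qed.

(** This identifies the pair produced by axiom (iv) when the codomain is cut down to [K]. *)
Lemma mstar_twpair L g K : (L :^ g)%g \subset K ->
  mstar (twpair A L g) (mdiag A K) = twpair A L g.
Proof.
rewrite mdiagE => sLK; apply: mpair_eq => [|p].
  apply/val_inj/setP => -[x y]; rewrite !inE /= mem_twdiag.
  apply/existsP/andP => [[z]|[xL /eqP ->]].
    rewrite !mem_twdiag /= conjg1 => /andP[/andP[xL /eqP ->]].
    by move=> /andP[_ /eqP ->].
  exists (x ^ g)%g; rewrite !mem_twdiag conjg1 xL !eqxx !andbT.
  by rewrite (fintype.subsetP sLK) // memJ_conjg.
rewrite mchar_mtriv; have [pP|pP] := boolP (p \in mgrp (mstar (twpair A L g) (twpair A K 1))).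
  rewrite mchar_mkpair //; case: ifP => // _; rewrite /star_char.
  by case: pickP => // x _; rewrite !mchar_mtriv addr0.
by rewrite mchar_out.
Qed.

(** Axiom (vi) gives the untwisted diagonal, and conjugating it by [(1, g^-1)] introduces the twist
    [g]. *)
Lemma twpair_SG L g : Sigma GG G L -> g \in G -> S L G (twpair A L g).
Proof.
move=> LG gG; have := Svi GG_G LG; rewrite mdiagE => /(Sii _ _) H.
have := H (1, g^-1)%g LG.2 GG_G; rewrite mconj_twpair invgK mul1g; apply.
by rewrite inE /= group1 groupV.
Qed.

Lemma twpair_S L g K : Sigma GG G L -> Sigma GG G K -> g \in G ->
  (L :^ g)%g \subset K -> S L K (twpair A L g).
Proof.
move=> LG KG gG sLK.
have [_] := Siv LG.2 GG_G (twpair_SG LG gG) KG; rewrite mstar_twpair //.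
suff -> : starl (mgrp (twpair A L g)) K = L by [].
apply/val_inj/setP => x; rewrite !inE /=.
apply/exists_inP/idP => [[y yK]|xL]; first by rewrite mem_twdiag => /andP[].
exists (x ^ g)%g; first by rewrite (fintype.subsetP sLK) // memJ_conjg.
by rewrite mem_twdiag xL eqxx.
Qed.

(** [GG] is not closed under conjugation by fiat: [lconjg g L] is the second projection of a twisted
    diagonal in [S], so axiom (vii) puts it in [GG]. *)
Lemma Sigma_conj L g : Sigma GG G L -> g \in G -> Sigma GG G (lconjg g L).
Proof.
move=> LG gG; split; first by apply: lconjg_sub => //; case: LG.
have gV : (g^-1)%g \in G by rewrite groupV.
have [+ _] := Svii LG.2 GG_G (twpair_SG LG gV); congr GG.
apply/val_inj/setP => x; rewrite mem_lconjg !inE /=.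
apply/existsP/idP => [[y]|xL]; last first.
  by exists (x ^ g)%g; rewrite mem_twdiag xL -conjgM mulgV conjg1 eqxx.
by rewrite mem_twdiag => /andP[yL /eqP ->]; rewrite -conjgM mulVg conjg1.
Qed.

(** Conjugation by [g] followed by restriction from [gKg^-1] to [L], meant for [L :^ g] contained in
    [K]. *)
Definition cF L g K : {linear fobj F K -> fobj F L} :=
  fmap F (fclass R (orbset (prodg L K) (twpair A L g))).

Lemma resFE L K : resF F L K = cF L 1 K.
Proof. by rewrite /resF mdiagE. Qed.

Lemma conjFE g L : conjF F g L = cF (lconjg g L) g L.
Proof. by rewrite /conjF /cF /twpair twdiag_conj. Qed.

Lemma homD_orbset L K P : S L K P -> homD S (fclass R (orbset (prodg L K) P)).
Proof.
move=> SP; exists 1%N, (fun=> 1), (fun=> P); split=> //.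
by rewrite big_ord1 scale1r.
Qed.

(** Functoriality of [F] turns [tensor_twpair] into the one composition rule for restrictions and
    conjugations. *)
Lemma cF_comp L g K h M v : Sigma GG G L -> Sigma GG G K -> Sigma GG G M ->
  g \in G -> h \in G -> (L :^ g)%g \subset K -> (K :^ h)%g \subset M ->
  cF L g K (cF K h M v) = cF L (g * h)%g M v.
Proof.
move=> LG KG MG gG hG sLK sKM; rewrite /cF -fmap_comp ?bcomp_class.
- by congr (fmap F _ v); apply/fclass_iso/fib_iso_sym/tensor_twpair.
- exact: LG.2.
- exact: KG.2.
- exact: MG.2.
- exact/homD_orbset/twpair_S.
- exact/homD_orbset/twpair_S.
Qed.

(** The two pairs are conjugate by an element of [1 x K], so their bisets are isomorphic. *)
Lemma cF_inner L g K k v : (L :^ g)%g \subset K -> k \in K ->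
  cF L (g * k)%g K v = cF L g K v.
Proof.
move=> sLK kK; congr (fmap F _ v); apply: fclass_iso.
have := @orbset_conj_iso A _ (prodg L K) (twpair A L g) (1, k^-1)%g.
by rewrite mconj_twpair invgK; apply; [exact: twdiag_sub|rewrite inE /= group1 groupV].
Qed.

Lemma cF_id L v : GG L -> cF L 1 L v = v.
Proof. by move=> LG; rewrite /cF -mdiagE fmap_id. Qed.

(** Equal subgroups need not be convertible, so values of [F] over them are compared through
    [atF]. *)
Lemma atF_cF L L' K K' g (v : fobj F K) (v' : fobj F K') : L = L' ->
  atF v = atF v' -> atF (cF L g K v) = atF (cF L' g K' v').
Proof.
move=> <- e; have eK : K = K' := congr1 tag e.
by case: K' / eK v' e => v' /atF_inj ->.
Qed.

Lemma cF_eq L K K' g (v : fobj F K) (v' : fobj F K') :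
  atF v = atF v' -> cF L g K v = cF L g K' v'.
Proof. by move=> e; apply: atF_inj; apply: atF_cF. Qed.

Lemma atF_conj1 L (v : fobj F L) : GG L -> atF (conjF F 1%g L v) = atF v.
Proof.
move=> LG; rewrite -[in RHS](cF_id v LG) conjFE.
by apply: atF_cF => //; exact: lconjg1.
Qed.

Lemma lconjg_conjs g L : (lconjg g L :^ g)%g \subset L.
Proof. by rewrite /lconjg /= -conjsgM mulVg conjsg1. Qed.

Lemma atF_conjM g h L (v : fobj F L) : Sigma GG G L -> g \in G -> h \in G ->
  atF (conjF F g _ (conjF F h L v)) = atF (conjF F (g * h)%g L v).
Proof.
move=> LG gG hG; have hL := Sigma_conj LG hG; have gL := Sigma_conj hL gG.
rewrite !conjFE cF_comp //; [|exact: lconjg_conjs..].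
by apply: atF_cF => //; rewrite lconjgM.
Qed.

Lemma atF_conj_in g l L (v : fobj F L) : l \in L ->
  atF (conjF F (g * l)%g L v) = atF (conjF F g L v).
Proof.
move=> lL; rewrite !conjFE; have e : lconjg (g * l)%g L = lconjg g L.
  by rewrite lconjgM (lconjg_in lL).
by rewrite e cF_inner //; exact: lconjg_conjs.
Qed.

Lemma gsec_act X (o : gobj F G X) g a x : g \in G ->
  atF (gsec o (fact (gfib o) g a x)) = atF (conjF F g _ (gsec o x)).
Proof.
move=> gG; rewrite -(gobj_sec o (- a) (fact (gfib o) g a x) gG).
by rewrite factVK.
Qed.

Lemma stab_Sigma X (o : gobj F G X) x : Sigma GG G (stab (gfib o) x).
Proof. by split; [exact: stab_sub|exact: gobj_GG]. Qed.

(** * Generators of F_+(G) *)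

Section Standard.
Variables (P : mpair A gT) (PG : Sigma GG G (mgrp P)).
Implicit Type b : fobj F (mgrp P).

(** The section takes the value [gb] at the coset of [(g, a)]. Another representative replaces [g]
    by [g * l] with [l] in the group of [P], and by [atF_conj_in] this does not change [gb]. *)
Lemma std_exists b : exists o, is_std (G := G) b o.
Proof.
have stC g a C : g \in G -> sval C = pcoset P g a ->
    stab (orbset G P) C = lconjg g (mgrp P).
  move=> gG e; have -> : C = fact (orbset G P) g a (orb_base G P).
    by apply: sval_inj; rewrite e /= orb_actE //= ltransE mulg1 addr0.
  rewrite -[LHS]/(mgrp (stab_pair (orbset G P) _)) stab_pair_act // stab_base //.
  exact: PG.1.
have vP C : exists v : fobj F (stab (orbset G P) C), forall g a, g \in G ->
    sval C = pcoset P g a -> atF v = atF (conjF F g _ b).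
  have [g [a [gG e]]] := svalP C.
  exists (castF (esym (stC _ _ _ gG e)) (conjF F g _ b)) => h c hG e'.
  rewrite atF_cast; have [l lP [-> _]] := pcoset_eq (etrans (esym e) e').
  by rewrite atF_conj_in.
pose s C := sval (cid (vP C)).
have sE C g a : g \in G -> sval C = pcoset P g a -> atF (s C) = atF (conjF F g _ b).
  by move=> gG e; rewrite /s; case: cid => v /= /(_ g a); apply.
have hG C : GG (stab (orbset G P) C).
  have [g [a [gG e]]] := svalP C.
  by rewrite (stC g a) //; case: (Sigma_conj PG gG).
have hs : is_section s.
  move=> g a C gG; have [h [c [hG' e]]] := svalP C.
  rewrite (sE C h c) // (@atF_conj _ _ _ _ F _ g _ _ _ (conjF F (g^-1 * h)%g _ b)); last first.
    apply: (sE _ _ (a + c)); first by rewrite groupM ?groupV.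
    by rewrite /= orb_actE ?groupV // e ltransE.
  by rewrite atF_conjM ?groupM ?groupV // mulKVg.
exists (GObj hG hs); split=> //=; rewrite (sE _ 1%g 0) //.
by apply: atF_conj1; exact: PG.2.
Qed.

Lemma is_stdE b o g a : is_std (G := G) b o -> g \in G ->
  atF (gsec o (fact (orbset G P) g a (orb_base G P))) = atF (conjF F g _ b).
Proof. by move=> [e eb] gG; rewrite -e gsec_act //; exact: atF_conj eb. Qed.

(** An equivariant section on one orbit is determined at the base point, so the choice made in
    [std_cls] is immaterial. *)
Lemma std_clsE b o : is_std (G := G) b o -> std_cls G b = gcls o.
Proof.
move=> ob; rewrite /std_cls; case: pselect => [h|[]]; last by exists o.
case: cid => o' ob' /=; congr gcls; apply: gobj_eq; first by rewrite ob'.1 ob.1.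
move=> C; have [g [a [gG ->]]] := orb_baseE C.
by rewrite (is_stdE _ ob gG) (is_stdE _ ob' gG).
Qed.

End Standard.

Lemma giso_bij X Y (o : gobj F G X) (o' : gobj F G Y) (f : X -> Y) :
  gmor o o' f -> injective f -> (forall y, exists x, f x = y) -> giso o o'.
Proof.
move=> [fm fs] fI fJ; have [f' f'K] := choice fJ.
have fK : cancel f f' by move=> x; apply: fI; rewrite f'K.
exists f, f'; split=> //; split=> [g a y gG|y].
  by apply: fI; rewrite fm // !f'K.
by rewrite -fs f'K.
Qed.

(** Both sections are equivariant and agree at the base point. *)
Lemma orbit_gmor X (o : gobj F G X) x o' :
  is_std (P := stab_pair (gfib o) x) (gsec o x) o' ->
  gmor o' o (@orbit_map _ _ _ _ (gfib o) x).
Proof.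
move=> ob; split=> [|C]; first by rewrite ob.1; exact: orbit_map_mor.
have [g [a [gG ->]]] := orb_baseE C.
by rewrite (is_stdE _ ob) // orbit_map_mor // orbit_map_base gsec_act.
Qed.

Lemma gcls_transitive X (o : gobj F G X) x :
  (forall y, exists g a, g \in G /\ y = fact (gfib o) g a x) ->
  gcls o = std_cls G (P := stab_pair (gfib o) x) (gsec o x).
Proof.
move=> tr; have [o' ob] := std_exists
  (stab_Sigma o x : Sigma GG G (mgrp (stab_pair _ x))) (gsec o x).
rewrite (std_clsE ob); apply/gcls_iso/giso_sym.
apply: (giso_bij (orbit_gmor ob)); first exact: orbit_map_inj.
move=> y; have [g [a [gG ->]]] := tr y.
exists (fact (orbset G _) g a (orb_base G _)).
by rewrite orbit_map_mor // orbit_map_base.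
Qed.

Lemma std_cls_eq P Q (b : fobj F (mgrp P)) (c : fobj F (mgrp Q)) :
  P = Q -> atF b = atF c -> std_cls G b = std_cls G c.
Proof. by move=> e; case: Q / e c => c /atF_inj ->. Qed.

(** One transitive object is read off at two of its points. *)
Lemma std_cls_conj P (b : fobj F (mgrp P)) g : Sigma GG G (mgrp P) -> g \in G ->
  std_cls G (P := mconj g P) (conjF F g _ b) = std_cls G b.
Proof.
move=> PG gG; have [o ob] := std_exists PG b; rewrite (std_clsE ob).
rewrite (@gcls_transitive _ o (fact (orbset G P) g 0 (orb_base G P))).
  apply: std_cls_eq; first by rewrite ob.1 stab_pair_act // stab_base //; case: PG.
  by rewrite (is_stdE _ ob).
rewrite ob.1 => C; have [h [a [hG ->]]] := orb_baseE C.
exists (h * g^-1)%g, a; rewrite groupM ?groupV //; split=> //.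
by rewrite -factM ?groupM ?groupV // mulgKV addr0.
Qed.

(** The defining relation concerns carriers ['I_n * A], so the three sections are transported to
    such a copy of [U]. *)
Lemma gcls_add X (U : fib A G X) (hU : forall x, GG (stab U x))
    (s t : forall x, fobj F (stab U x)) (hs : is_section s) (ht : is_section t) :
  gcls (GObj hU (add_sec_proof hs ht)) = gcls (GObj hU hs) + gcls (GObj hU ht).
Proof.
have [n [f [f' [fK f'K]]]] := fib_carrier U.
pose W := fib_transport U fK f'K.
have fm : fib_mor W U f by move=> g a y gG /=; rewrite f'K.
have stE y : stab U (f y) = stab W y.
  by apply/esym/stab_mor => //; exact: can_inj fK.
have hW y : GG (stab W y) by rewrite -stE.
pose tr (u : forall x, fobj F (stab U x)) y := castF (stE y) (u (f y)).
have trP u : is_section u -> is_section (tr u).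
  move=> hu g a y gG; rewrite /tr atF_cast -(hu g a (f y) gG) -fm ?groupV //.
  by apply: atF_conj; exact: atF_cast.
have trE u (hu : is_section u) (v : forall y, fobj F (stab W y)) (hv : is_section v) :
    (forall y, atF (v y) = atF (u (f y))) -> gcls (GObj hU hu) = gcls (GObj hW hv).
  move=> e; apply/gcls_iso/giso_sym/(@giso_bij _ _ _ _ f).
  - by split=> // x; rewrite -e.
  - exact: can_inj fK.
  - by move=> x; exists (f' x).
rewrite (trE s hs _ (trP s hs)) => [|y]; last exact: atF_cast.
rewrite (trE t ht _ (trP t ht)) => [|y]; last exact: atF_cast.
rewrite (trE _ _ _ (add_sec_proof (trP s hs) (trP t ht))) => [|y]; last first.
  by apply: atF_add; exact: atF_cast.
pose q (o : gobj F G ('I_n * A)) := gcls_small (Tagged (fun n => gobj F G ('I_n * A)) o).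
rewrite !q.
rewrite -[RHS]/(pm_add _ _) -Defs.pi_add; apply/presmodP/modeq_rel; exact: gam_add.
Qed.

Lemma std_cls_linear P (r : R) (b c : fobj F (mgrp P)) : Sigma GG G (mgrp P) ->
  std_cls G (r *: b + c) = r *: std_cls G b + std_cls G c.
Proof.
move=> PG; have [o [eo ob]] := std_exists PG b; have [p [ep pc]] := std_exists PG c.
rewrite (std_clsE (conj eo ob)) (std_clsE (conj ep pc)) gcls_scale.
(* The two standard objects live on [orbset G P] up to equality; substituting it lets their sections
   be added. *)
case: o eo ob => U s hU hs /= eU; case: p ep pc => V t hV ht /= eV.
move: U eU V eV s hU hs t hV ht => _ -> _ -> s hU hs t hV ht pc ob.
rewrite /gscale /= (Prop_irrelevance hV hU) -gcls_add; apply: std_clsE.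
by split=> //=; apply: atF_add => //; exact: (atF_map (fun=> *:%R r) ob).
Qed.

(** [Fplus] is presented over the integers, and integer multiples are iterated sums and
    opposites. *)
Lemma Fplus_zmod_ind (Psi : Fplus F G -> Prop) : Psi 0 ->
  (forall x y, Psi x -> Psi y -> Psi (x + y)) -> (forall x, Psi x -> Psi (- x)) ->
  (forall X (o : gobj F G X), Psi (gcls o)) -> forall x, Psi x.
Proof.
move=> P0 PD PN Pg; elim/quotW => t; rewrite -modeval_gen.
have Pn x n : Psi x -> Psi (x *+ n).
  by move=> Px; elim: n => [|n IH]; rewrite ?mulr0n // mulrS; exact: PD.
elim: t => //= [o|s Ps t Pt|t Pt|z t Pt]; [|exact: PD|exact: PN|].
  by have := Pg _ (tagged o); rewrite gcls_small.
rewrite -[z]intz scaler_int; case: z => n; first exact: Pn.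
by rewrite NegzE mulrNz; apply/PN/Pn.
Qed.

(** * Decomposition into orbits *)

Section Empty.
Definition void_fib : fib A G void.
Proof.
refine (@Fib _ _ _ _ (fun _ _ x => x) _ _ _ _) => //.
by apply: (@sub_finite_set _ _ set0) => // _ [[]].
Defined.

Definition void_obj : gobj F G void.
Proof.
by refine (@GObj _ _ _ _ _ _ _ _ void_fib (fun x => match x with end) _ _) => [|g a] [].
Defined.

(** The empty object is isomorphic to the disjoint union of two copies of itself, so its class [x]
    satisfies [x + x = x]. *)
Lemma gcls_void : gcls void_obj = 0.
Proof.
apply: (addrI (gcls void_obj)); rewrite addr0 -gcls_sum; apply: gcls_iso.
apply: (@giso_bij _ _ _ _ (fun z : void + void => match z with inl x | inr x => x end)).
- by split=> [g a|] [] [].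
- by move=> [] [].
- by case.
Qed.
End Empty.

Lemma std_cls0 P : Sigma GG G (mgrp P) -> std_cls G (0 : fobj F (mgrp P)) = 0.
Proof.
by move=> PG; have := std_cls_linear (-1) 0 0 PG; rewrite scaler0 addr0 scaleN1r addNr.
Qed.

Lemma std_clsD P (b c : fobj F (mgrp P)) : Sigma GG G (mgrp P) ->
  std_cls G (b + c) = std_cls G b + std_cls G c.
Proof. by move=> PG; have := std_cls_linear 1 b c PG; rewrite !scale1r. Qed.

Lemma std_clsN P (b : fobj F (mgrp P)) : Sigma GG G (mgrp P) ->
  std_cls G (- b) = - std_cls G b.
Proof.
move=> PG; have := std_cls_linear (-1) b 0 PG.
by rewrite std_cls0 // !addr0 !scaleN1r.
Qed.

(** The representatives of the [A]-orbits are added one by one: each lies in a [G]-orbit already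
    covered or contributes a new standard summand. *)
Lemma gcls_decomp (Psi : Fplus F G -> Prop) : Psi 0 ->
  (forall x y, Psi x -> Psi y -> Psi (x + y)) ->
  (forall P (b : fobj F (mgrp P)), Sigma GG G (mgrp P) -> Psi (std_cls G b)) ->
  forall X (o : gobj F G X), Psi (gcls o).
Proof.
move=> P0 PD Ps X o; have [n [r rP]] := fib_reps (gfib o).
(* o' is a disjoint union of standard objects that f identifies with the union
   of the G-orbits of the first k representatives. *)
pose in_orb i x := exists g a, g \in G /\ x = fact (gfib o) g a (r i).
suff /(_ n (leqnn n))[Y [o' [f [fm fI fJ Po']]]] : forall k : nat, (k <= n)%N ->
    exists Y (o' : gobj F G Y) (f : Y -> X), [/\ gmor o' o f, injective f,
      forall x, (exists y, f y = x) <-> (exists i : 'I_n, (i < k)%N /\ in_orb i x)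
      & Psi (gcls o')].
  rewrite -(gcls_iso (giso_bij fm fI _)) // => x; apply/fJ.
  have [i [[a ->] _]] := rP x; exists i; split=> //.
  by exists 1%g, a; split.
elim=> [_|k IH kn].
  exists void, void_obj, (fun x : void => match x with end).
  split; [by split=> [g a|] []|by case| |by rewrite gcls_void].
  by move=> x; split=> [[[]]|[i []]].
have [Y [o' [f [[fm fs] fI fJ Po']]]] := IH (ltnW kn).
pose i0 := Ordinal kn; have [old|new] := pselect (exists y, f y = r i0).
  exists Y, o', f; split=> // x; apply: iff_trans (fJ x) _; split=> -[i [ik xi]].
    by exists i; rewrite ltnS ltnW.
  move: ik; rewrite ltnS leq_eqVlt => /orP[/eqP ik|ik]; last by exists i.
  have ei : i = i0 by exact: val_inj.
  have [j [jk [h [b [hG e]]]]] := (fJ _).1 old; exists j; split=> //.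
  have [g [a [gG ->]]] := xi; rewrite ei e.
  by exists (g * h)%g, (a + b); rewrite groupM // factM.
have SG := stab_Sigma o (r i0) : Sigma GG G (mgrp (stab_pair (gfib o) (r i0))).
have [p pb] := std_exists SG (gsec o (r i0)); have [hm hs] := orbit_gmor pb.
set h := @orbit_map _ _ _ _ _ _ in hm hs.
have hI : injective h by exact: orbit_map_inj.
have hE g a : g \in G -> h (fact (orbset G _) g a (orb_base G _)) =
    fact (gfib o) g a (r i0).
  by move=> gG; rewrite /h orbit_map_mor // orbit_map_base.
(* If the images met, translating back would put [r i0] in the image of [f]. *)
have fh y z : f y <> h z.
  move=> e; apply: new; have [g [a [gG ez]]] := orb_baseE z.
  exists (fact (gfib o') g^-1%g (- a) y).
  by rewrite fm ?groupV // e ez hE // factVK.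
exists (Y + orbcar G (stab_pair (gfib o) (r i0)))%type, (gsum o' p).
exists (fun z => match z with inl y => f y | inr z => h z end); split.
- split=> [g a [y|z] gG|[y|z]] /=; rewrite ?fm ?hm // atF_cast //.
- move=> [y|z] [y'|z'] => [/fI ->|/fh|/esym/fh|/hI ->] //.
- move=> x; split=> [[[y|z] <-]|[i [ik xi]]].
  + have [i [ik xi]] := (fJ (f y)).1 (ex_intro _ y erefl).
    by exists i; rewrite ltnS ltnW.
  + exists i0; split=> //; have [g [a [gG ->]]] := orb_baseE z.
    by exists g, a; rewrite hE.
  + move: ik; rewrite ltnS leq_eqVlt => /orP[/eqP ik|ik].
      have ei : i = i0 by exact: val_inj.
      have [g [a [gG ->]]] := xi; rewrite ei.
      by exists (inr (fact (orbset G _) g a (orb_base G _))); rewrite hE.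
    have [y <-] := (fJ x).2 (ex_intro _ i (conj ik xi)).
    by exists (inl y).
- rewrite gcls_sum -(std_clsE pb); apply: PD => //; exact: Ps.
Qed.

(** Opposites of generators are generators, as [- [P, b] = [P, - b]]. Proving [Psi] for [x] and
    [- x] together therefore handles negation. *)
Lemma Fplus_ind (Psi : Fplus F G -> Prop) :
  (forall x y, Psi x -> Psi y -> Psi (x + y)) ->
  (forall P (b : fobj F (mgrp P)), Sigma GG G (mgrp P) -> Psi (std_cls G b)) ->
  forall x, Psi x.
Proof.
move=> PD Ps; pose Psi' x := Psi x /\ Psi (- x).
have T1 : Sigma GG G (mgrp (mtriv A G)) by split.
(* Zero is the generator with value 0 at the pair formed by [G] and its trivial character. *)
have P0 : Psi 0 by rewrite -(std_cls0 T1); exact: Ps.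
suff H x : Psi' x by move=> x; case: (H x).
apply: Fplus_zmod_ind x => [|x y [x1 x2] [y1 y2]|x [x1 x2]|].
- by split; rewrite ?oppr0.
- by split; rewrite ?opprD; exact: PD.
- by split; rewrite ?opprK.
apply: gcls_decomp => [|x y [x1 x2] [y1 y2]|P b PG].
- by split; rewrite ?oppr0.
- by split; rewrite ?opprD; exact: PD.
- by split; rewrite -?std_clsN //; exact: Ps.
Qed.

(** * Marks *)

Lemma mpleP (P Q : mpair A gT) : reflect
  (forall x, x \in mgrp P -> x \in mgrp Q /\ mchar P x = mchar Q x) (mple P Q).
Proof.
apply: (iffP andP) => [[/fintype.subsetP sPQ /forall_inP e] x xP|H].
  by split; [exact: sPQ|exact/eqP/e].
by split; [apply/fintype.subsetP => x /H[]|apply/forall_inP => x /H[_ ->]].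
Qed.

Lemma mple_trans (Q P T : mpair A gT) : mple P Q -> mple Q T -> mple P T.
Proof.
by move=> /mpleP PQ /mpleP QT; apply/mpleP => x /PQ[/QT[? <-] ->].
Qed.

Lemma mple_anti (P Q : mpair A gT) : mple P Q -> mple Q P -> P = Q.
Proof.
move=> /mpleP PQ /mpleP QP; have e : mgrp P = mgrp Q.
  by apply/val_inj/setP => x; apply/idP/idP => [/PQ[]|/QP[]].
apply: mpair_eq => // x; have [/PQ[] //|xP] := boolP (x \in mgrp P).
by rewrite !mchar_out // -e.
Qed.

Lemma mple_conjr (P Q : mpair A gT) g : mple P Q -> mple (mconj g P) (mconj g Q).
Proof.
by move=> /mpleP PQ; apply/mpleP => x; rewrite !mem_lconjg !mchar_conj => /PQ.
Qed.

Lemma mple_conj (P Q : mpair A gT) g : mple (mconj g P) Q = mple P (mconj g^-1%g Q).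
Proof.
apply/idP/idP => /(mple_conjr _); first by move/(_ g^-1%g); rewrite -mconjM mulVg mconj1.
by move/(_ g); rewrite -mconjM mulgV mconj1.
Qed.

Local Notation mp := (mprime A GG G).

Lemma mpgrp_Sigma (P : mp) : Sigma GG G (mpgrp P).
Proof. by have /andP[? /asboolP ?] := valP P. Qed.

Lemma mprime_exists (P : mpair A gT) : Sigma GG G (mgrp P) -> exists Q : mp, val Q = P.
Proof.
move=> PG; have h : (mgrp P \subset G) && `[< GG (mgrp P) >].
  by rewrite PG.1; apply/asboolP; exact: PG.2.
by exists (MPrime h).
Qed.

(** A pair below [Q] is determined by its group, its character being a restriction, and there are
    finitely many subgroups even if [A] is infinite. *)
Lemma finite_lower (Q : mpair A gT) : finite_set [set P : mp | mple (val P) Q].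
Proof.
pose f (P : mp) := if mple (val P) Q then Some (mpgrp P) else None.
have -> : [set P : mp | mple (val P) Q] = f @^-1` [set x | x != None].
  by apply/seteqP; split=> P /=; rewrite /f; case: ifP.
apply: finite_preimage; last exact: finite_finset.
move=> P P'; rewrite !inE /= /f; case: ifP => // /mpleP PQ _; case: ifP => // /mpleP P'Q _.
move=> [e]; apply/val_inj/mpair_eq => [|x]; first exact: e.
have [xP|xP] := boolP (x \in mpgrp P).
  have [_ ->] := PQ _ xP; rewrite e in xP.
  by have [_ ->] := P'Q _ xP.
by rewrite mchar_out //; rewrite e in xP; rewrite mchar_out.
Qed.

(** This is [orbit_reps] for any finite index type, so that a sum type can index a transversal of a
    disjoint union. *)
Definition orbit_transversal X (U : fib A G X) (I : finType) (r : I -> X) : Prop :=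
  forall x, exists! i, exists a, x = fact U 1%g a (r i).

Definition mark_sum X (o : gobj F G X) (I : finType) (r : I -> X) (P : mp) :
    fobj F (mpgrp P) :=
  \sum_(i | mple (val P) (stab_pair (gfib o) (r i)))
    resF F (mpgrp P) (stab (gfib o) (r i)) (gsec o (r i)).

Lemma stab_pairA X (U : fib A G X) a x : stab_pair U (fact U 1%g a x) = stab_pair U x.
Proof. by rewrite stab_pair_act // mconj1. Qed.

Lemma gsecA X (o : gobj F G X) a x :
  atF (gsec o (fact (gfib o) 1%g a x)) = atF (gsec o x).
Proof. by rewrite gsec_act // atF_conj1 //; exact: gobj_GG. Qed.

(** The indices are matched through the [A]-orbits, on which stabilizer pairs and sections are
    constant. The identity isomorphism gives independence of the transversal. *)
Lemma mark_sum_iso X Y (o : gobj F G X) (o' : gobj F G Y) (I J : finType)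
    (r : I -> X) (r' : J -> Y) P :
  orbit_transversal (gfib o) r -> orbit_transversal (gfib o') r' -> giso o o' ->
  mark_sum o r P = mark_sum o' r' P.
Proof.
move=> rP r'P [f [f' [[fm fs] _ fK f'K]]].
have [h hP] := choice (fun i => r'P (f (r i))).
have [h' h'P] := choice (fun j => rP (f' (r' j))).
have e i : exists a, f (r i) = fact (gfib o') 1%g a (r' (h i)) := (hP i).1.
have hK : cancel h h'.
  move=> i; apply: (h'P (h i)).2; have [a ea] := e i.
  exists (- a); apply: (can_inj fK).
  by rewrite f'K fm // ea -factM ?group1 // mulg1 addNr fact1.
have h'K : cancel h' h.
  move=> j; apply: (hP (h' j)).2; have [a ea] := (h'P j).1.
  exists (- a); rewrite -(f'K (r' j)) ea fm //.
  by rewrite -factM ?group1 // mulg1 addNr fact1.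
rewrite /mark_sum [RHS](reindex h) /=; last by exists h' => ? _.
have eS i : stab_pair (gfib o') (r' (h i)) = stab_pair (gfib o) (r i).
  have [a ea] := e i.
  by rewrite -(stab_pair_mor _ fm (can_inj fK)) ea stab_pairA.
apply: eq_big => i; first by rewrite eS.
move=> _; have [a ea] := e i; rewrite !resFE; apply: cF_eq.
by rewrite -fs ea gsecA.
Qed.

Definition mark X (o : gobj F G X) (P : mp) : fobj F (mpgrp P) :=
  let: exist n h := cid (fib_reps (gfib o)) in mark_sum o (sval (cid h)) P.

Lemma mark_sumE X (o : gobj F G X) (I : finType) (r : I -> X) P :
  orbit_transversal (gfib o) r -> mark o P = mark_sum o r P.
Proof.
move=> rP; rewrite /mark; case: cid => n h; case: cid => r' r'P /=.
exact: mark_sum_iso (giso_refl o).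
Qed.

Lemma mark_iso X Y (o : gobj F G X) (o' : gobj F G Y) P :
  giso o o' -> mark o P = mark o' P.
Proof.
have [n [r rP]] := fib_reps (gfib o); have [n' [r' r'P]] := fib_reps (gfib o').
by rewrite (mark_sumE _ rP) (mark_sumE _ r'P); exact: mark_sum_iso.
Qed.

Lemma mark_gsum X Y (o : gobj F G X) (o' : gobj F G Y) P :
  mark (gsum o o') P = mark o P + mark o' P.
Proof.
have [n [r rP]] := fib_reps (gfib o); have [n' [r' r'P]] := fib_reps (gfib o').
rewrite (mark_sumE _ rP) (mark_sumE _ r'P).
pose t (z : 'I_n + 'I_n') : X + Y :=
  match z with inl i => inl (r i) | inr j => inr (r' j) end.
rewrite (@mark_sumE _ _ _ t); last first.
  case=> x.
    have [i [[a ea] iu]] := rP x; exists (inl i); split.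
      by exists a; rewrite /= -ea.
    by move=> [j|j] [b] //= [eb]; congr inl; apply: iu; exists b.
  have [i [[a ea] iu]] := r'P x; exists (inr i); split.
    by exists a; rewrite /= -ea.
  by move=> [j|j] [b] //= [eb]; congr inr; apply: iu; exists b.
have sl x : stab_pair (gfib (gsum o o')) (inl x) = stab_pair (gfib o) x.
  by apply: stab_pair_mor => // ? ? [].
have sr x : stab_pair (gfib (gsum o o')) (inr x) = stab_pair (gfib o') x.
  by apply: stab_pair_mor => // ? ? [].
rewrite /mark_sum big_sumType /=; congr (_ + _).
  apply: eq_big => i; first by rewrite sl.
  by move=> _; rewrite !resFE; apply: cF_eq; rewrite atF_cast.
apply: eq_big => i; first by rewrite sr.
by move=> _; rewrite !resFE; apply: cF_eq; rewrite atF_cast.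
Qed.

Lemma mark_add X (U : fib A G X) (hU : forall x, GG (stab U x))
    (s t : forall x, fobj F (stab U x)) (hs : is_section s) (ht : is_section t) P :
  mark (GObj hU (add_sec_proof hs ht)) P = mark (GObj hU hs) P + mark (GObj hU ht) P.
Proof.
have [n [r rP]] := fib_reps U.
have mE u (hu : is_section u) : mark (GObj hU hu) P = mark_sum (GObj hU hu) r P.
  exact: mark_sumE.
rewrite !mE /mark_sum /= -big_split /=.
by apply: eq_bigr => i _; rewrite linearD.
Qed.

Lemma mark_scale X (o : gobj F G X) c P : mark (gscale c o) P = c *: mark o P.
Proof.
have [n [r rP]] := fib_reps (gfib o).
have rP' : orbit_transversal (gfib (gscale c o)) r := rP.
rewrite (mark_sumE _ rP) (mark_sumE _ rP') /mark_sum /=.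
by rewrite scaler_sumr; apply: eq_bigr => i _; rewrite linearZ.
Qed.

(** A nonzero mark sits below one of finitely many stabilizer pairs. *)
Lemma mark_fin X (o : gobj F G X) : finite_set [set P | mark o P != 0].
Proof.
have [n [r rP]] := fib_reps (gfib o).
apply: (@sub_finite_set _ _
  (\bigcup_(i in [set: 'I_n]) [set P : mp | mple (val P) (stab_pair (gfib o) (r i))])).
  move=> P /=; rewrite (mark_sumE _ rP) /mark_sum => nz.
  have [[i iP]|no] := pselect (exists i, mple (val P) (stab_pair (gfib o) (r i))).
    by exists i.
  move: nz; rewrite big1 ?eqxx // => i iP.
  by case: no; exists i.
by apply: bigcup_finite => // i _; exact: finite_lower.
Qed.

Lemma atF_sum (I : finType) (p q : pred I) K L (v : I -> fobj F K) (w : I -> fobj F L) :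
  K = L -> p =1 q -> (forall i, p i -> atF (v i) = atF (w i)) ->
  atF (\sum_(i | p i) v i) = atF (\sum_(i | q i) w i).
Proof.
move=> e; case: L / e w => w pq vw; congr atF; apply: eq_big => // i pi.
exact/atF_inj/vw.
Qed.

(** The mark at [Q] is computed with the transversal translated by [g], which matches the two sums
    term by term. *)
Lemma mark_inv X (o : gobj F G X) g (P Q : mp) : g \in G -> val Q = mconj g (val P) ->
  atF (conjF F g _ (mark o P)) = atF (mark o Q).
Proof.
move=> gG e; have [n [r rP]] := fib_reps (gfib o).
have eQ : mpgrp Q = lconjg g (mpgrp P) by rewrite /mpgrp e.
rewrite (mark_sumE _ rP) (@mark_sumE _ _ _ (fun i => fact (gfib o) g 0 (r i))).
  rewrite /mark_sum linear_sum; apply: atF_sum => // i.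
    by rewrite e stab_pair_act // mple_conj -mconjM mulVg mconj1.
  move=> /andP[iP _]; rewrite conjFE !resFE.
  rewrite cF_comp ?mul1g ?mulg1 ?conjsg1 ?lconjg_conjs //;
    [|exact: Sigma_conj (mpgrp_Sigma P) gG|exact: mpgrp_Sigma|exact: stab_Sigma].
  rewrite (@cF_eq _ _ _ 1%g _ (conjF F g _ (gsec o (r i)))) ?gsec_act //.
  have cS := Sigma_conj (stab_Sigma o (r i)) gG.
  have sQ : mpgrp Q \subset lconjg g (stab (gfib o) (r i)).
    by rewrite eQ conjSg.
  rewrite conjFE cF_comp ?mul1g ?conjsg1 ?lconjg_conjs ?group1 //;
    [|exact: mpgrp_Sigma|exact: stab_Sigma].
  by apply: atF_cF.
move=> x; have [i [[a ea] iu]] := rP (fact (gfib o) g^-1%g 0 x); exists i.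
split=> [|j [b eb]]; last first.
  apply: iu; exists b; rewrite eb factAC ?groupV //.
  by have := factVK (gfib o) 0 (r j) gG; rewrite oppr0 => ->.
exists a; rewrite -(factK (gfib o) 0 x gG) oppr0 ea; exact: factAC.
Qed.

(** * The mark homomorphism *)

Definition mark_fam X (o : gobj F G X) : Fupper F G := MkFupper (mark_fin o) (@mark_inv X o).

Lemma fuD (x y : Fupper F G) P : fufun (x + y) P = fufun x P + fufun y P.
Proof. by []. Qed.
Lemma fuZ c (x : Fupper F G) P : fufun (c *: x) P = c *: fufun x P.
Proof. by []. Qed.

(** [zmodule] regards the target as a module over the integers, over which [Fplus] is presented;
    [mmapZ] then gives [R]-linearity. *)
Definition mmap (x : Fplus F G) : Fupper F G :=
  modeval (M := zmodule (Fupper F G)) (fun o : sgobj F G => mark_fam (tagged o))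
    (generic_quotient.repr x).

Lemma mmap_pi t : mmap (\pi_(Fplus F G)%qT t) =
  modeval (M := zmodule (Fupper F G)) (fun o : sgobj F G => mark_fam (tagged o)) t.
Proof.
apply: (@modeval_eq _ _ (@gam_rel A GG S R F gT G) (zmodule (Fupper F G))
  (fun o => mark_fam (tagged o))); last exact: modeq_repr.
move=> _ _ [o o' oo'|o o' o'' oo'|n U hU s t' hs ht] /=.
- by apply: fu_eq => P; exact: mark_iso.
- by apply: fu_eq => P; rewrite [RHS]fuD /= (mark_iso _ oo') mark_gsum.
- by apply: fu_eq => P; rewrite [RHS]fuD /= mark_add.
Qed.

Lemma mmap_gcls X (o : gobj F G X) : mmap (gcls o) = mark_fam o.
Proof.
rewrite /gcls /pmgen mmap_pi /=; apply: fu_eq => P.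
exact: mark_iso (giso_sym (gsmallP o)).
Qed.

Lemma mmapD : {morph mmap : x y / x + y}.
Proof.
elim/quotW=> s; elim/quotW=> t.
by rewrite -[_ + _ in LHS]/(pm_add _ _) -Defs.pi_add !mmap_pi.
Qed.

Lemma mmap0 : mmap 0 = 0.
Proof. by apply: (addrI (mmap 0)); rewrite -mmapD !addr0. Qed.
Lemma mmapN x : mmap (- x) = - mmap x.
Proof. by apply: (addrI (mmap x)); rewrite -mmapD !subrr mmap0. Qed.

Lemma mmapZ c x : mmap (c *: x) = c *: mmap x.
Proof.
elim/Fplus_zmod_ind: x => [|x y|x|X o].
- by rewrite scaler0 mmap0 scaler0.
- by rewrite scalerDr !mmapD scalerDr => -> ->.
- by rewrite scalerN !mmapN scalerN => ->.
rewrite gcls_scale !mmap_gcls; apply: fu_eq => P.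
by rewrite fuZ /= mark_scale.
Qed.

Lemma mmap_linear : linear mmap.
Proof. by move=> c x y; rewrite mmapD mmapZ. Qed.

(** Each [A]-orbit of [orbset G P] is reached from the base point by one left coset of the group of
    [P]. The factor on the left thus turns the sum over orbits into a sum over [G]. *)
Lemma mmap_std (P : mpair A gT) (b : fobj F (mgrp P)) (T : mp) : Sigma GG G (mgrp P) ->
  fufun (mmap (std_cls G b)) T *+ #|mgrp P| =
  \sum_(g in G | mple (val T) (mconj g P)) cF (mpgrp T) g (mgrp P) b.
Proof.
move=> PG; have [o ob] := std_exists PG b.
rewrite (std_clsE ob) mmap_gcls /=.
have [n [r rP]] := fib_reps (orbset G P).
have rP' : orbit_transversal (gfib o) r by rewrite ob.1.
rewrite (mark_sumE _ rP') /mark_sum.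
pose base g := fact (orbset G P) g 0 (orb_base G P).
(* [ix g] indexes the [A]-orbit of the base point translated by [g]. *)
have [ix ixP] := choice (fun g => rP (base g)).
have baseE g h a : g \in G -> h \in G ->
    base g = fact (orbset G P) 1%g a (base h) -> (g^-1 * h)%g \in mgrp P.
  move=> gG hG; rewrite /base -[X in _ = X]factM ?group1 // mul1g.
  move/(fact_orbit_eq _ _ _ _ gG hG); rewrite stab_base; last exact: PG.1.
  by move=> /pcoset_eq[l lP [-> _]]; rewrite mulKg.
have ixE g h : g \in G -> h \in G -> (ix g == ix h) = (g^-1 * h \in mgrp P)%g.
  move=> gG hG; apply/eqP/idP => [e|lP].
    have [a ea] := (ixP g).1; have [c ec] := (ixP h).1.
    apply: (baseE _ _ (a - c)) => //.
    by rewrite ec -e factA0 -[X in fact _ _ a X]factM ?group1 // mulg1 addNr fact1.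
  apply: (ixP g).2; have [c ec] := (ixP h).1.
  exists (- mchar P (g^-1 * h)%g + c); rewrite factA0 -ec /base -factM ?group1 //.
  rewrite mul1g addr0; apply/fact_orbit_eq => //; rewrite stab_base; last exact: PG.1.
  by rewrite -(pcosetM g 0 lP) mulKVg sub0r.
pose term i := if mple (val T) (stab_pair (gfib o) (r i))
  then resF F (mpgrp T) (stab (gfib o) (r i)) (gsec o (r i)) else 0.
rewrite big_mkcond -/(term _) [RHS]big_mkcondr /=.
have tE g : g \in G -> term (ix g) =
    if mple (val T) (mconj g P) then cF (mpgrp T) g (mgrp P) b else 0.
  move=> gG; have [a ea] := (ixP g).1.
  have bE : atF (gsec o (base g)) = atF (conjF F g _ b) by exact: is_stdE.
  have eS : stab_pair (gfib o) (r (ix g)) = mconj g P.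
    rewrite -(stab_pairA (gfib o) a) ob.1 -ea stab_pair_act // stab_base //.
    exact: PG.1.
  rewrite /term eS; case: ifP => // /andP[sTP _].
  rewrite resFE (@cF_eq _ _ _ 1%g _ (conjF F g _ b)); last first.
    by rewrite -bE ea -[in RHS]ob.1 gsecA.
  rewrite conjFE cF_comp ?mul1g ?conjsg1 ?lconjg_conjs ?group1 //.
    exact: mpgrp_Sigma.
  exact: Sigma_conj.
rewrite -(eq_bigr _ tE) (partition_big ix xpredT) //= -sumrMnl.
apply: eq_bigr => i _; rewrite (eq_bigr (fun=> term i)); last first.
  by move=> g /andP[_ /eqP ->].
rewrite sumr_const; congr (_ *+ _).
(* The fibre of [ix] over [i] is the left coset of [g0], whence the multiplicity. *)
have [g0 [a [g0G e0]]] := orb_baseE (r i).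
have ei : ix g0 = i.
  apply: (ixP g0).2; exists (- a); rewrite e0 /base -[RHS]factM ?group1 //.
  by rewrite mul1g addNr.
rewrite -(card_lcoset (mgrp P) g0); apply: eq_card => g.
rewrite mem_lcoset [RHS]unfold_in /= -ei; have [gG|gG] := boolP (g \in G).
  by rewrite eq_sym ixE.
apply/negbTE; apply: contra gG => gP; rewrite -(mulKVg g0 g) groupM //.
exact: fintype.subsetP PG.1 _ gP.
Qed.

(** * Moebius inversion *)

Lemma mprime_le_refl (P : mp) : mprime_le P P.
Proof. exact: mple_refl. Qed.

Lemma mprime_le_trans (Q P T : mp) : mprime_le P Q -> mprime_le Q T -> mprime_le P T.
Proof. exact: mple_trans. Qed.

Lemma moebius_eq0 (P Q : mp) : ~~ mprime_le P Q -> moebius P Q = 0.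
Proof.
move=> nPQ; rewrite moebiusE (negPf nPQ); case: eqP => // e.
by move: nPQ; rewrite e mprime_le_refl.
Qed.

(** Down-closure ensures that every interval ending in [e] lies in [e], so Moebius inversion can be
    carried out inside [e]. *)
Definition lower_seq (e : seq mp) : Prop :=
  uniq e /\ forall P Q, mprime_le P Q -> Q \in e -> P \in e.

Lemma lower_seq_exists (D : set mp) : finite_set D ->
  exists e, lower_seq e /\ forall P, D P -> P \in e.
Proof.
move=> fD; pose E := \bigcup_(Q in D) [set P : mp | mple (val P) (val Q)].
have fE : finite_set E by apply: bigcup_finite => // Q _; exact: finite_lower.
exists (finmap.enum_fset (fset_set E)); split=> [|P DP]; last first.
  by rewrite in_fset_set // inE; exists P => //=; exact: mple_refl.
split=> [|P Q PQ]; first exact: finmap.fset_uniq.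
rewrite !in_fset_set // !inE => -[T DT QT]; exists T => //=.
exact: mple_trans QT.
Qed.

Lemma big_seq_condD1 (V : zmodType) (I : eqType) (e : seq I) (p : pred I) j (f : I -> V) :
  uniq e -> j \in e -> p j ->
  \sum_(i <- e | p i) f i = f j + \sum_(i <- e | p i && (i != j)) f i.
Proof.
move=> ue je pj; rewrite -big_filter (bigD1_seq j) ?filter_uniq ?mem_filter ?pj //=.
by rewrite big_filter_cond.
Qed.

Section MoebiusInversion.
Variable e : seq mp.
Hypothesis eL : lower_seq e.

(** For [P != Q] this is the recursion defining [moebius], with the term [T = Q] separated from the
    others. *)
Lemma moebius_suml P Q : Q \in e -> mprime_le P Q ->
  \sum_(T <- e | mprime_le P T && mprime_le T Q) moebius P T = (P == Q)%:R.
Proof.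
move=> Qe PQ; rewrite (big_seq_condD1 _ eL.1 Qe) ?PQ ?mprime_le_refl //=.
have [<-|nPQ] := eqVneq P Q.
  rewrite moebiusE eqxx big_pred0 ?addr0 // => T; apply/negbTE.
  apply/negP => /andP[/andP[PT TP]] /eqP; apply.
  by apply/val_inj/mple_anti.
rewrite moebiusE (negPf nPQ) PQ.
rewrite (fsbigE [seq T <- e | [&& mprime_le P T, mprime_le T Q & T != Q]]).
- rewrite big_filter_cond; apply/eqP; rewrite addrC subr_eq0; apply/eqP.
  apply: eq_bigl => T; rewrite -andbA.
  by case: (boolP [&& _, _ & _]) => // h; apply/esym/mem_set.
- by rewrite filter_uniq // eL.1.
- by move=> T /=; rewrite mem_filter => /andP[].
- move=> T /= h; rewrite mem_filter h /= => /negP[].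
  by have /and3P[_ TQ _] := h; exact: eL.2 TQ Qe.
Qed.

Lemma moebius_sumr P Q : Q \in e -> mprime_le P Q ->
  \sum_(T <- e | mprime_le P T && mprime_le T Q) moebius T Q = (P == Q)%:R.
Proof.
move=> Qe PQ; have Pe := eL.2 _ _ PQ Qe.
(* moebius_suml says M *m Z = 1, and one-sided inverses of square matrices are
   two-sided. *)
pose t := tnth (in_tuple e).
have tI : injective t by apply/tuple_uniqP; exact: eL.1.
pose M := \matrix_(i < size e, j < size e) moebius (t i) (t j).
pose Z := \matrix_(i < size e, j < size e) ((mprime_le (t i) (t j))%:R : int).
have MZ : M *m Z = 1%:M.
  apply/matrixP => i k; rewrite !mxE -(inj_eq tI).
  have [ik|nik] := boolP (mprime_le (t i) (t k)).
    rewrite -moebius_suml ?mem_tnth // [RHS]big_tnth [RHS]big_mkcond /=.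
    apply: eq_bigr => j _; rewrite !mxE -/(t j).
    have [ij|/moebius_eq0 ->] := boolP (mprime_le (t i) (t j)); last by rewrite mul0r.
    by rewrite mulr_natr mulrb.
  rewrite big1 => [|j _]; first by case: eqP nik => // ->; rewrite mprime_le_refl.
  rewrite !mxE; have [ij|/moebius_eq0 ->] := boolP (mprime_le (t i) (t j));
    last by rewrite mul0r.
  have [jk|_] := boolP (mprime_le (t j) (t k)); last by rewrite mulr0.
  by move: nik; rewrite (mprime_le_trans ij jk).
have /tnthP[i ei] : P \in in_tuple e by [].
have /tnthP[k ek] : Q \in in_tuple e by [].
have := congr1 (fun B : 'M_(size e) => B i k) (mulmx1C MZ).
rewrite !mxE -(inj_eq tI) /t -ei -ek => <-.
rewrite [LHS]big_tnth [LHS]big_mkcond /=; apply: eq_bigr => j _.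
rewrite !mxE -/(t j) /t -ei -ek.
have [jk|/moebius_eq0 ->] := boolP (mprime_le _ Q); last by rewrite mulr0 andbF.
by rewrite andbT mulr_natl mulrb.
Qed.

Definition nterm (x : Fupper F G) (P Q : mp) : Fplus F G :=
  std_cls G (P := val P) (resF F (mpgrp P) (mpgrp Q) (fufun x Q))
    *~ (#|mpgrp P|%:Z * moebius P Q).

(** A pair with [Q] outside [e] contributes [[P, 0] = 0], and down-closure brings [P] into [e] along
    with [Q]. *)
Lemma nmapE (x : Fupper F G) : (forall Q, fufun x Q != 0 -> Q \in e) ->
  nmap x = \sum_(Q <- e) \sum_(P <- e | mprime_le P Q) nterm x P Q.
Proof.
move=> xe; rewrite /nmap.
pose r := [seq p <- [seq (P, Q) | Q <- e, P <- e] | mprime_le p.1 p.2].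
rewrite (fsbigE r).
- rewrite big_filter_cond big_mkcond big_allpairs_dep /=; apply: eq_bigr => Q _.
  rewrite [RHS]big_mkcond; apply: eq_bigr => P _ /=.
  case: ifP => [/andP[-> //]|]; case: ifP => //= PQ /negP[].
  exact/mem_set.
- rewrite filter_uniq // allpairs_uniq ?eL.1 // => -[a b] [c d] _ _ [-> ->] //.
- by move=> p /=; rewrite mem_filter => /andP[].
- move=> [P Q] /= PQ; rewrite mem_filter /= PQ /= => h.
  have -> : fufun x Q = 0.
    apply/eqP; apply: contraNT h => /xe Qe; apply/allpairsP; exists (Q, P).
    by split=> //=; exact: eL.2 PQ Qe.
  by rewrite linear0 std_cls0 ?mul0rz //; exact: mpgrp_Sigma.
Qed.
End MoebiusInversion.

(** One sequence containing both supports serves for all three sums, which then compare termwise. *)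
Lemma nmap_linear c (x y : Fupper F G) : nmap (c *: x + y) = c *: nmap x + nmap y.
Proof.
have fD : finite_set ([set P | fufun x P != 0] `|` [set P | fufun y P != 0]).
  by rewrite finite_setU; split; exact: fu_fin.
have [e [eL eD]] := lower_seq_exists fD.
rewrite !(nmapE eL) => [|Q yQ|Q xQ|Q].
- rewrite scaler_sumr -big_split; apply: eq_bigr => Q _ /=.
  rewrite scaler_sumr -big_split; apply: eq_bigr => P _ /=.
  rewrite /nterm fuD fuZ linearP std_cls_linear; last exact: mpgrp_Sigma.
  by rewrite mulrzDl scalerMzr.
- by apply: eD; right.
- by apply: eD; left.
- rewrite fuD fuZ => nz; apply: eD; have [x0|xQ] := eqVneq (fufun x Q) 0; last by left.
  by right; move: nz; rewrite x0 scaler0 add0r.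
Qed.

Lemma nmapD (x y : Fupper F G) : nmap (x + y) = nmap x + nmap y.
Proof. by have := nmap_linear 1 x y; rewrite !scale1r. Qed.

Lemma nmap0 : nmap (0 : Fupper F G) = 0.
Proof. by apply: (addrI (nmap 0)); rewrite -nmapD !addr0. Qed.

Lemma nmapMn (x : Fupper F G) n : nmap (x *+ n) = nmap x *+ n.
Proof. by elim: n => [|n IH]; rewrite ?mulr0n ?nmap0 // !mulrS nmapD IH. Qed.

Lemma fuMn (x : Fupper F G) n P : fufun (x *+ n) P = fufun x P *+ n.
Proof. by elim: n => [|n IH]; rewrite ?mulr0n // !mulrS fuD IH. Qed.

(** * The two composites *)

Lemma finite_conj_lower (P : mpair A gT) :
  finite_set [set T : mp | exists2 g, g \in G & mple (val T) (mconj g P)].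
Proof.
have -> : [set T : mp | exists2 g, g \in G & mple (val T) (mconj g P)] =
    \bigcup_(g in [set g | g \in G]) [set T : mp | mple (val T) (mconj g P)].
  by apply/seteqP; split=> T [g gG gT']; exists g.
by apply: bigcup_finite => [|g _]; [exact: finite_finset|exact: finite_lower].
Qed.

Lemma std_cls_sum (P : mpair A gT) (I : finType) (p : pred I) (v : I -> fobj F (mgrp P)) :
  Sigma GG G (mgrp P) -> std_cls G (\sum_(i | p i) v i) = \sum_(i | p i) std_cls G (v i).
Proof. by move=> PG; apply: big_morph => [? ?|]; rewrite ?std_clsD ?std_cls0. Qed.

(** The factor from the integral formula is kept on both sides; it is cancelled once [|G|] is
    inverted. *)
Lemma nmap_mmap_std (P : mpair A gT) (b : fobj F (mgrp P)) : Sigma GG G (mgrp P) ->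
  nmap (mmap (std_cls G b)) *+ #|mgrp P| = std_cls G b *+ #|G| *+ #|mgrp P|.
Proof.
move=> PG; rewrite -nmapMn; set Y := mmap _ *+ _.
have YE T : fufun Y T =
    \sum_(g in G | mple (val T) (mconj g P)) cF (mpgrp T) g (mgrp P) b.
  by rewrite fuMn mmap_std.
have [e [eL eD]] := lower_seq_exists (finite_conj_lower P).
rewrite (nmapE eL) => [|Q]; last first.
  rewrite YE => nz; apply: eD.
  have [//|no] := pselect (exists2 g, g \in G & mple (val Q) (mconj g P)).
  move: nz; rewrite big_pred0 ?eqxx // => g; apply/negbTE/negP => /andP[gG QP].
  by case: no; exists g.
(* After composing restrictions, the summand depends on [Q] only through the Moebius function. *)
pose X g (T Q : mp) : Fplus F G :=
  std_cls G (P := val T) (cF (mpgrp T) g (mgrp P) b) *~ (#|mpgrp T|%:Z * moebius T Q).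
have -> : \sum_(Q <- e) \sum_(T <- e | mprime_le T Q) nterm Y T Q =
    \sum_(Q <- e) \sum_(T <- e) \sum_(g in G)
      if mprime_le T Q && mple (val Q) (mconj g P) then X g T Q else 0.
  apply: eq_bigr => Q _; rewrite big_mkcond; apply: eq_bigr => T _.
  case: ifP => TQ /=; last by rewrite big1.
  rewrite -big_mkcondr /nterm YE linear_sum std_cls_sum; last exact: mpgrp_Sigma.
  rewrite mulrz_suml; apply: eq_bigr => g /andP[gG /andP[sQP _]].
  have sTQ : mpgrp T \subset mpgrp Q by case/andP: TQ.
  rewrite /X resFE cF_comp ?mul1g ?conjsg1 ?group1 //; try exact: mpgrp_Sigma.
  by apply: fintype.subset_trans (lconjg_conjs g (mgrp P)); rewrite conjSg.
rewrite exchange_big /= (eq_bigr (fun T => \sum_(g in G) \sum_(Q <- e)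
  if mprime_le T Q && mple (val Q) (mconj g P) then X g T Q else 0)); last first.
  by move=> T _; rewrite exchange_big.
rewrite exchange_big /= -mulrnA mulnC mulrnA -sumr_const; apply: eq_bigr => g gG.
(* [Q0] is [gP], the top of the intervals over which [Q] now ranges. *)
have [Q0 eQ0] := mprime_exists (Sigma_conj PG gG : Sigma GG G (mgrp (mconj g P))).
have Q0e : Q0 \in e by apply: eD; exists g => //; rewrite eQ0 mple_refl.
have XQ T : \sum_(Q <- e) (if mprime_le T Q && mple (val Q) (mconj g P) then X g T Q else 0)
    = if T == Q0 then std_cls G b *+ #|mgrp P| else 0.
  have [TQ0|nTQ0] := boolP (mprime_le T Q0); last first.
    rewrite big1 => [|Q _]; first by case: eqP nTQ0 => // ->; rewrite mprime_le_refl.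
    case: ifP => // /andP[TQ]; rewrite -eQ0 => QQ0.
    by move: nTQ0; rewrite (mprime_le_trans TQ QQ0).
  rewrite -big_mkcond -eQ0 /X -mulrz_sumr -mulr_sumr (moebius_suml eL) //.
  case: eqP => [->|_]; last by rewrite mulr0 mulr0z.
  (* At [T = gP] the remaining term is [|gP| [gP, gb]], which is [|P| [P, b]]. *)
  rewrite mulr1; have cE : #|mpgrp Q0| = #|mgrp P|.
    by rewrite /mpgrp eQ0 cardJg.
  rewrite cE -pmulrn; congr (_ *+ _); rewrite -(std_cls_conj b PG gG).
  apply: std_cls_eq => //; rewrite conjFE; apply: atF_cF => //.
  by rewrite /mpgrp eQ0.
rewrite (eq_bigr _ (fun T _ => XQ T)) -big_mkcond (big_seq_condD1 _ eL.1 Q0e) //=.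
by rewrite big_pred0 ?addr0 // => T; case: eqP.
Qed.

Lemma morphMz (V W : zmodType) (f : V -> W) : {morph f : x y / x + y} ->
  forall x n, f (x *~ n) = f x *~ n.
Proof.
move=> fD; have f0 : f 0 = 0 by apply: (addrI (f 0)); rewrite -fD !addr0.
have fN x : f (- x) = - f x by apply: (addrI (f x)); rewrite -fD !subrr.
have fMn x n : f (x *+ n) = f x *+ n.
  by elim: n => [|n IH]; rewrite ?mulr0n // !mulrS fD IH.
move=> x [] n; first exact: fMn.
by rewrite NegzE !mulrNz fN -[RHS]/(- (f x *+ n.+1)) -fMn.
Qed.

Lemma mmap_nmap (a : Fupper F G) : mmap (nmap a) = a *+ #|G|.
Proof.
apply: fu_eq => T; rewrite fuMn.
(* The second set brings every [g^-1 T] into the sequence, even where [a] vanishes. *)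
have fD : finite_set ([set P | fufun a P != 0] `|`
    [set Q : mp | exists2 g, g \in G & mple (val Q) (mconj g (val T))]).
  by rewrite finite_setU; split; [exact: fu_fin|exact: finite_conj_lower].
have [e [eL eD]] := lower_seq_exists fD.
rewrite (nmapE eL) => [|Q aQ]; last by apply: eD; left.
pose m x := fufun (mmap x) T.
have mD : {morph m : x y / x + y} by move=> x y; rewrite /m mmapD.
have m0 : m 0 = 0 by rewrite /m mmap0.
rewrite -/(m _) (big_morph m mD m0).
pose X g (P Q : mp) := cF (mpgrp T) g (mpgrp Q) (fufun a Q) *~ moebius P Q.
rewrite (eq_bigr (fun Q => \sum_(P <- e) \sum_(g in G)
    if mprime_le P Q && mple (val T) (mconj g (val P)) then X g P Q else 0)); last first.
  move=> Q _; rewrite (big_morph m mD m0) big_mkcond; apply: eq_bigr => P _.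
  case: ifP => PQ /=; last by rewrite big1.
  (* The factor [|P|] in the definition of [nmap] is the one that the integral formula absorbs. *)
  rewrite -big_mkcondr /nterm (morphMz mD) mulrzA -pmulrn /m.
  rewrite (mmap_std (P := val P)) ?mpgrp_Sigma //; last exact: mpgrp_Sigma.
  rewrite mulrz_suml; apply: eq_bigr => g /andP[gG /andP[sTP _]].
  have sPQ : mpgrp P \subset mpgrp Q by case/andP: PQ.
  rewrite /X resFE cF_comp ?mulg1 ?conjsg1 ?group1 //; try exact: mpgrp_Sigma.
  by apply: fintype.subset_trans (lconjg_conjs g (mpgrp P)); rewrite conjSg.
rewrite (eq_bigr (fun Q => \sum_(g in G) \sum_(P <- e)
    if mprime_le P Q && mple (val T) (mconj g (val P)) then X g P Q else 0)); last first.
  by move=> Q _; rewrite exchange_big.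
rewrite exchange_big /= -sumr_const; apply: eq_bigr => g gG.
have gVG : (g^-1)%g \in G by rewrite groupV.
(* [T'] is [g^-1 T], the bottom of the intervals over which [P] ranges. *)
have [T' eT'] := mprime_exists
  (Sigma_conj (mpgrp_Sigma T) gVG : Sigma GG G (mgrp (mconj g^-1%g (val T)))).
have T'e : T' \in e.
  by apply: eD; right; exists g^-1%g => //; rewrite eT' mple_refl.
have TP P : mple (val T) (mconj g (val P)) = mprime_le T' P.
  by rewrite /mprime_le eT' mple_conj invgK.
(* Conjugation by [g] carries the component of [a] at [g^-1 T] to the one at [T], by invariance of
   the family. *)
have aT : cF (mpgrp T) g (mpgrp T') (fufun a T') = fufun a T.
  apply: atF_inj; rewrite -(@fu_inv _ _ _ _ _ _ _ a g T' T gG); last first.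
    by rewrite eT' -mconjM mulgV mconj1.
  rewrite conjFE; apply: atF_cF => //.
  by rewrite /mpgrp eT' -[RHS]lconjgM mulgV lconjg1.
have XQ Q : Q \in e -> \sum_(P <- e)
    (if mprime_le P Q && mple (val T) (mconj g (val P)) then X g P Q else 0)
    = if Q == T' then fufun a T else 0.
  move=> Qe; have [T'Q|nT'Q] := boolP (mprime_le T' Q); last first.
    rewrite big1 => [|P _]; first by case: eqP nT'Q => // ->; rewrite mprime_le_refl.
    case: ifP => // /andP[PQ]; rewrite TP => T'P.
    by move: nT'Q; rewrite (mprime_le_trans T'P PQ).
  rewrite -big_mkcond (eq_bigl (fun P => mprime_le T' P && mprime_le P Q)); last first.
    by move=> P; rewrite TP andbC.
  rewrite /X -mulrz_sumr (moebius_sumr eL) // eq_sym.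
  by case: eqP => [->|_]; rewrite ?mulr1z ?mulr0z.
rewrite (eq_big_seq _ XQ) -big_mkcond (big_seq_condD1 _ eL.1 T'e) //=.
by rewrite big_pred0 ?addr0 // => Q; case: eqP.
Qed.

End Functor.

Theorem corollary6p4 (A : zmodType) (R : comPzRingType)
    (GG : grpclass) (S : pairfamily A) (S_on : family_on GG S)
    (Si : axiom_i GG S) (Sii : axiom_ii GG S) (Siii : axiom_iii GG S)
    (Siv : axiom_iv GG S) (Svi : axiom_vi GG S) (Svii : axiom_vii GG S)
    (Sviii : axiom_viii GG S)
    (F : functorD GG S R) (gT : finGroupType) (G : {group gT}) (GG_G : GG gT G)
    (invG : R) (invGP : invG * #|G|%:R = 1) :
  exists m : {linear Fplus F G -> Fupper F G},
    [/\ is_mark m,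
        forall m' : {linear Fplus F G -> Fupper F G}, is_mark m' -> m' =1 m,
        linear (fun x : Fupper F G => invG *: nmap x),
        cancel m (fun x : Fupper F G => invG *: nmap x)
      & cancel (fun x : Fupper F G => invG *: nmap x) m].
Proof.
pose mm : Fplus F G -> Fupper F G := mmap Sii Siv Svi Svii GG_G.
have lin : linear mm by exact: mmap_linear.
pose m : {linear Fplus F G -> Fupper F G} :=
  HB.pack mm
    (GRing.isLinear.Build R (Fplus F G) (Fupper F G) *:%R mm lin).
have mP : is_mark m.
  by move=> X o n r rP P; rewrite [m _]mmap_gcls; exact: mark_sumE.
have scaleG (V : lmodType R) (v : V) : invG *: (v *+ #|G|) = v.
  by rewrite -scaler_nat scalerA invGP scale1r.
have nlin : linear (fun x : Fupper F G => invG *: nmap x).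
  move=> c x y /=; rewrite nmap_linear // scalerDr !scalerA.
  by rewrite [invG * c]mulrC.
exists m; split=> //.
(* The mark formula fixes a linear map on all classes [[X, s]], and these generate [Fplus]. *)
- move=> m' m'P x; elim/Fplus_zmod_ind: x => [|x y|x|X o].
  + by rewrite !linear0.
  + by rewrite !linearD => -> ->.
  + by rewrite !linearN => ->.
  have [n [r rP]] := fib_reps (gfib o).
  by apply: fu_eq => P; rewrite (m'P _ _ _ _ rP) (mP _ _ _ _ rP).
- have nD x y : nmap (mm (x + y)) = nmap (mm x) + nmap (mm y) :> Fplus F G.
    by rewrite /mm mmapD nmapD.
  move=> x /=; rewrite -[RHS]scaleG; congr (_ *: _).
  elim/Fplus_ind: x => // [x y ex ey|P b PG]; first by rewrite nD ex ey mulrnDl.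
  (* As [|P|] divides the invertible [|G|], multiplication by [|P|] is injective. *)
  have [j ej] : exists j, #|G| = (#|mgrp P| * j)%N.
    by exists (#|G| %/ #|mgrp P|)%N; rewrite mulnC divnK // cardSg //; case: PG.
  have cancelP : injective (fun v : Fplus F G => v *+ #|mgrp P|).
    move=> v w /= e; rewrite -[v]scaleG -[w]scaleG ej !mulrnA.
    by rewrite e.
  by apply: cancelP => /=; rewrite nmap_mmap_std.
- move=> a; rewrite [LHS]mmapZ mmap_nmap; exact: scaleG.
Qed.
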